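(* Assume (in ZFC) that there exists a well-order of the Baire space $\mathcal{N}=\omega^\omega$ which, as a subset of $\mathcal{N}\times\mathcal{N}$, is $\mathbf{\Delta}^1_2$. Then for every locally countable Borel graph $G$ we have $\chi_{\mathbf{\Delta}^1_2}(G)=\chi(G)$.
   Context: The boldface projective classes $\mathbf{\Sigma}^1_n,\mathbf{\Pi}^1_n,\mathbf{\Delta}^1_n$ are the usual ones on Polish spaces. A graph is a pair $G=(V,E)$ with $E\subseteq V\times V$ symmetric; a Polish graph is one whose vertex set $V$ is a Polish space; a Borel graph is a Polish graph with $E$ a Borel subset of $V^2$. $G$ is locally countable if every vertex has at most countably many neighbours. For a cardinal $\kappa$, a $\kappa$-colouring is a map from $V$ to a set of cardinality $\kappa$ assigning distinct values to adjacent vertices; $\chi(G)$ is the least $\kappa$ for which one exists. For a pointclass $\mathbf{P}$, a $\mathbf{P}$ class $\kappa$-colouring is a $\kappa$-colouring each of whose colour classes (preimages of single colours) is in $\mathbf{P}$, and $\chi_{\mathbf{P}}(G)$ is the least $\kappa$ for which a $\mathbf{P}$ class $\kappa$-colouring exists. *)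

(* Defs.v *)
From HB Require Import structures.
From mathcomp Require Import all_boot.
From mathcomp Require Import wochoice.
From mathcomp Require Import all_classical reals topology measure.

Set Implicit Arguments.
Unset Strict Implicit.
Unset Printing Implicit Defensive.

Local Open Scope classical_set_scope.
Local Open Scope card_scope.

(* The library's [completeType] is pointed; spelling completeness out keeps
   the empty Polish space. *)
Definition complete_space (M : uniformType) : Prop :=
  forall F : set_system M, ProperFilter F -> cauchy F -> exists l : M, F --> l.

Definition homeomorphic (V W : topologicalType) : Prop :=
  exists (f : V -> W) (g : W -> V),
    [/\ cancel f g, cancel g f, continuous f & continuous g].

Definition completely_metrizable (V : topologicalType) : Prop :=
  exists (R : realType) (M : metricType R),
    complete_space M /\ homeomorphic V M.

Definition separable (V : topologicalType) : Prop :=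
  exists2 D : set V, countable D & dense D.

Definition polish (V : topologicalType) : Prop :=
  separable V /\ completely_metrizable V.

Definition baire_space : Type := prod_topology (fun _ : nat => nat).

HB.instance Definition _ := Pointed.on baire_space.
HB.instance Definition _ := Nbhs.on baire_space.
HB.instance Definition _ := Topological.on baire_space.
HB.instance Definition _ := Uniform.on baire_space.

Definition Borel (X : topologicalType) : set (set X) := <<s @open X >>.

(* Level 0 is Borel, so that level 1 consists of the projections along the
   Baire space of Borel sets, i.e., the analytic sets when X is Polish. *)
Fixpoint Sigma1 (n : nat) (X : topologicalType) : set (set X) :=
  if n is m.+1 then
    [set A | exists2 B : set (X * baire_space), Sigma1 m (~` B) & A = fst @` B]
  else @Borel X.

Definition Pi1 (n : nat) (X : topologicalType) : set (set X) :=
  [set A | Sigma1 n (~` A)].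

Definition Delta1 (n : nat) (X : topologicalType) : set (set X) :=
  @Sigma1 n X `&` @Pi1 n X.

Definition is_graph (V : Type) (E : set (V * V)) : Prop :=
  forall x y, E (x, y) -> E (y, x).

Definition borel_graph (V : topologicalType) (E : set (V * V)) : Prop :=
  [/\ polish V, is_graph E & Borel E].

Definition locally_countable (V : Type) (E : set (V * V)) : Prop :=
  forall x, countable [set y | E (x, y)].

Definition coloring (V K : Type) (E : set (V * V)) (c : V -> K) : Prop :=
  forall x y, E (x, y) -> c x <> c y.

Definition class_coloring (V K : Type) (P : set (set V)) (E : set (V * V))
    (c : V -> K) : Prop :=
  coloring E c /\ forall k, P (c @^-1` [set k]).

(* The least cardinal satisfying Q, as the class of all the types having that
   cardinality: the library has no type of cardinals, only the relations #<=
   and #=.  The three lemmas below show that it is well defined. *)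
Definition least_cardinal (Q : set Type) : set Type :=
  [set K | Q K /\ forall L : Type, Q L -> [set: K] #<= [set: L]].

Definition chi (V : Type) (E : set (V * V)) : set Type :=
  least_cardinal [set K | exists c : V -> K, coloring E c].

Definition chi_class (V : Type) (P : set (set V)) (E : set (V * V)) : set Type :=
  least_cardinal [set K | exists c : V -> K, class_coloring P E c].

Lemma least_cardinal_unique (Q : set Type) (K L : Type) :
  least_cardinal Q K -> least_cardinal Q L -> [set: K] #= [set: L].
Proof.
by move=> [QK leK] [QL leL]; rewrite card_eq_le leK ?leL.
Qed.

Lemma least_cardinal_nonempty (Q : set Type) :
  Q !=set0 -> least_cardinal Q !=set0.
Proof.
move=> [K0 QK0]; pose I := {K : Type | Q K}.
pose T := forall i : I, sval i.
pose P : set (set T) :=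
  [set S | forall i (s t : T), S s -> S t -> s i = t i -> s = t].
have [F FP Ftot|S [PS Smax]] := @Zorn_bigcup T P.
  move=> i s t [A FA As] [B FB Bt].
  have [AB|BA] := Ftot _ _ FA FB.
  - by apply: (FP _ FB i) => //; exact: AB.
  - by apply: (FP _ FA i) => //; exact: BA.
have [[i si]|/forallNP nsurj] :=
    pselect (exists i : I, forall k, exists2 s : T, S s & s i = k).
  exists (sval i); split; first exact: (proj2_sig i).
  move=> L QL; pose f k := sval (cid2 (si k)) (exist _ L QL).
  suff finj : injective f.
    have fE : f @` setT #= [set: sval i]
      by apply: inj_card_eq => x y _ _; exact: finj.
    by rewrite -(card_le_eql fE); exact/subset_card_le/subsetT.
  move=> k l; rewrite /f; case: cid2 => s Ss sk; case: cid2 => t St tl /= st.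
  by rewrite -sk -tl (PS (exist _ L QL) _ _ Ss St st).
have avoid i : {k : sval i | forall s : T, S s -> s i <> k}.
  apply: cid; have /existsNP[k nk] := nsurj i.
  by exists k => s Ss sk; apply: nk; exists s.
pose a : T := fun i => sval (avoid i).
have aS i s : S s -> s i <> a i by exact: (proj2_sig (avoid i)).
case: (Smax (S `|` [set a])).
  split=> [s|/(_ a)]; first by left.
  by move=> /(_ (or_intror erefl)) Sa; exact: (aS (exist _ K0 QK0) a Sa).
move=> i s t [Ss|->] [St|->] // st.
- exact: PS st.
- by case: (aS i s Ss).
- by case: (aS i t St).
Qed.

Lemma chi_nonempty (V : Type) (E : set (V * V)) :
  (forall x, ~ E (x, x)) -> chi E !=set0.
Proof.
move=> irr; apply: least_cardinal_nonempty; exists V; exists id => x y Exy xy.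
by move: Exy xy => /[swap] /= ->; exact: irr.
Qed.

(* Main.v *)
Require Import Defs.
From HB Require Import structures.
From mathcomp Require Import all_boot all_order all_algebra.
From mathcomp Require Import wochoice.
From mathcomp Require Import all_classical reals topology measure.
From mathcomp Require Import lra.

(**
The hypothesis does not say that initial segments of the well-order can be coded
uniformly, so taking the least real that codes a coloring would give Sigma^1_3.
Instead only countable sets are ever minimized over: a quantifier ranging over
the connected component [x] of x, which is countable, becomes a number
quantifier once an enumeration y of [x] is guessed, so the least element m(x) of
[x] is a Delta^1_2 function of x.

To enumerate [m] from m, write the connectedness relation as the projection
along a continuous map pi of a closed set F, so that pi has countably many
values on the section F_m.  By Baire category, repeatedly removing the nodes
(basic clopen sets) below which pi takes at most one value exhausts F_m.  The
order in which the nodes are removed is the only prewellorder of the nodes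
satisfying a countable conjunction of Boolean combinations of Sigma^1_1
conditions, and sending a node to the only value of pi left below it when it is
removed is a partial map from the nodes onto [m].  So there is a Delta^1_2 map
iota to the natural numbers, injective on each component.

If there are infinitely many colors, iota is the coloring.  If there are
finitely many, the colorings of [x], read along iota, form a nonempty closed
subset of the Baire space determined by one real, and its leftmost element is
Pi^1_1 in that real.  The case of a general Polish space reduces to the Baire
space by sending x to the indices of the first points of a dense sequence that
approximate x to within each eps_n.
*)

Set Implicit Arguments.
Unset Strict Implicit.
Unset Printing Implicit Defensive.

Local Open Scope classical_set_scope.

Local Notation N := baire_space.

(** * Closure properties of the projective classes *)

Definition agree (n : nat) (u v : N) : Prop := forall i, (i < n)%N -> v i = u i.

Lemma agree_leq (m n : nat) (u v : N) : (m <= n)%N -> agree n u v -> agree m u v.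
Proof. by move=> mn uv i im; apply: uv; exact: leq_trans mn. Qed.

Lemma coord_continuous (n : nat) : continuous (fun u : N => u n : nat).
Proof. exact: (@proj_continuous nat (fun=> nat) n). Qed.

Lemma baire_continuous (X : topologicalType) (f : X -> N) :
  (forall n, continuous (fun x => f x n : nat)) -> continuous f.
Proof.
move=> fc x; apply/cvg_sup => n; apply/cvg_image.
  by rewrite eqEsubset; split=> // k _; exists (fun=> k).
move=> A /= nA; have := fc n x _ nA; rewrite /= => fA.
exists [set u | A (u n)]; first exact: fA.
rewrite eqEsubset; split => [_ [u /= Au <-]//|k Ak].
by exists (fun=> k).
Qed.

Lemma nbhs_agree (n : nat) (u : N) : nbhs u (agree n u).
Proof.
elim: n => [|n IH]; first by apply: filterS filterT => v _ i.
have : nbhs u [set v : N | v n = u n].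
  by apply: (@coord_continuous n u [set u n]); apply/principal_filterP.
apply: filterS2 IH => v uv /= vn i; rewrite ltnS leq_eqVlt => /orP[/eqP->//|].
exact: uv.
Qed.

(** If no cylinder around [u] lay inside [A], points chosen outside [A] in longer and longer
    cylinders would converge to [u]. *)
Lemma nbhs_agreeP (u : N) (A : set N) :
  nbhs u A <-> exists n, agree n u `<=` A.
Proof.
split=> [|[n nA]]; last exact: filterS (nbhs_agree n u).
pose x (n : nat) (v : N) : N := fun i => if (i < n)%N then u i else v i.
move=> uA; apply: contrapT => /forallNP h.
have /choice[v vP] n : exists v, agree n u v /\ ~ A v.
  by apply: contrapT => /forallNP k; apply: (h n) => v uv; apply: contrapT => Av; apply: (k v).
have cv : v @ \oo --> u.
  apply/cvg_sup => n; apply/cvg_image.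
    by rewrite eqEsubset; split=> // k _; exists (fun=> k).
  move=> B /= /principal_filterP Bu; exists [set w : N | B (w n)]; last first.
    rewrite eqEsubset; split => [_ [w /= Bw <-]//|k Bk].
    by exists (fun=> k).
  exists n.+1 => // k /= nk; rewrite (vP k).1//.
have [k _ /(_ k (leqnn k))] := cv _ uA.
exact: (vP k).2.
Qed.

(** A single real codes a sequence of reals: [weave] encodes and [sec] decodes. Several real
    witnesses are thus packed under one quantifier. *)
Definition sec (i : nat) (w : N) : N := fun n => w (pickle (i, n)).

Definition weave (y : nat -> N) : N := fun k =>
  if unpickle k is Some (i, n) then y i n else 0.

Lemma sec_weave y i : sec i (weave y) = y i.
Proof. by apply/funext => n; rewrite /sec /weave pickleK. Qed.

Lemma sec_continuous i : continuous (sec i).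
Proof. by apply: baire_continuous => n; exact: coord_continuous. Qed.

Section borel.
Variable X : topologicalType.
Implicit Type A : set X.

Lemma borel_ind (P : set X -> Prop) :
  (forall A, open A -> P A) -> (forall A, P A -> P (~` A)) ->
  (forall F : nat -> set X, (forall n, P (F n)) -> P (\bigcup_n F n)) ->
  forall A, Borel A -> P A.
Proof.
move=> Po PC PU; suff : @Borel X `<=` P by [].
apply: (@smallest_sub _ (sigma_algebra setT) open P) => //; split=> //; first exact/Po/open0.
by move=> A PA; rewrite setTD; exact: PC.
Qed.

Lemma borel_open A : open A -> Borel A.
Proof. by move=> oA; apply: sub_sigma_algebra. Qed.

Lemma borelC A : Borel A -> Borel (~` A).
Proof. by move=> BA; rewrite -setTD; apply: sigma_algebraCD. Qed.

Lemma borel_bigcup (F : nat -> set X) : (forall n, Borel (F n)) -> Borel (\bigcup_n F n).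
Proof. by move=> BF; apply: sigma_algebra_bigcup. Qed.

Lemma borel_bigcap (F : nat -> set X) : (forall n, Borel (F n)) -> Borel (\bigcap_n F n).
Proof.
by move=> BF; rewrite -[X in Borel X]setCK setC_bigcap; apply: borelC; apply: borel_bigcup => n;
  apply: borelC.
Qed.

End borel.

Lemma borel_preimage (X Y : topologicalType) (f : X -> Y) (A : set Y) :
  continuous f -> Borel A -> Borel (f @^-1` A).
Proof.
move=> fc; move: A; apply: borel_ind => [A oA|A|F].
- by apply: borel_open; apply: open_comp => // x _; exact: fc.
- exact: borelC.
- by rewrite preimage_bigcup; exact: borel_bigcup.
Qed.

Lemma cts_pair (X Y Z : topologicalType) (f : X -> Y) (g : X -> Z) :
  continuous f -> continuous g -> continuous (fun x => (f x, g x)).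
Proof. by move=> fc gc x; apply: cvg_pair; [exact: fc|exact: gc]. Qed.

Lemma cts_fst (X Y : topologicalType) : continuous (@fst X Y).
Proof. by move=> x; exact: cvg_fst. Qed.

Lemma cts_snd (X Y : topologicalType) : continuous (@snd X Y).
Proof. by move=> x; exact: cvg_snd. Qed.

Lemma cts_comp (X Y Z : topologicalType) (f : X -> Y) (g : Y -> Z) :
  continuous f -> continuous g -> continuous (fun x => g (f x)).
Proof. by move=> fc gc x; apply: continuous_comp; [exact: fc|exact: gc]. Qed.

Lemma cts_id (X : topologicalType) : continuous (fun x : X => x).
Proof. by move=> x; exact: cvg_id. Qed.

Local Ltac cont := repeat first
  [ exact: cts_id | exact: cts_fst | exact: cts_snd
  | exact: sec_continuous | exact: coord_continuous
  | apply: cts_pair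
  | apply: (cts_comp _ (@cts_fst _ _))
  | apply: (cts_comp _ (@cts_snd _ _))
  | apply: (cts_comp _ (@sec_continuous _))
  | apply: (cts_comp _ (@coord_continuous _)) ].

Lemma sigma_preimage (n : nat) (X Y : topologicalType) (f : X -> Y) (A : set Y) :
  continuous f -> Sigma1 n A -> Sigma1 n (f @^-1` A).
Proof.
elim: n X Y f A => [|n IH] X Y f A fc; first exact: borel_preimage.
move=> [B sB ->].
pose g (p : X * N) := (f p.1, p.2).
exists (g @^-1` B).
  rewrite preimage_setC; apply: IH => //.
  by apply: cts_pair; cont; apply: (cts_comp (@cts_fst _ _)).
rewrite eqEsubset; split => [x [[y u] /= Byu yx]|_ [[x u] /= Bu <-]].
  by exists (x, u) => //; rewrite /g/= -yx.
by exists (f x, u).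
Qed.

(** Unions and intersections go through one induction because each level is built on complements of
    the level below, and these exchange the two. *)
Lemma sigma_bigcupcap (n : nat) : forall (X : topologicalType) (F : nat -> set X),
  (forall i, Sigma1 n (F i)) ->
  Sigma1 n (\bigcup_i F i) /\ Sigma1 n (\bigcap_i F i).
Proof.
elim: n => [|n IH] X F sF.
  by split; [exact: borel_bigcup|exact: borel_bigcap].
have /choice[B BP] i : exists B : set (X * N), Sigma1 n (~` B) /\ F i = fst @` B.
  by have [B ? ?] := sF i; exists B.
split.
  exists (\bigcup_i B i).
    by rewrite setC_bigcup; apply: (IH _ _ _).2 => i; exact: (BP i).1.
  by rewrite image_bigcup; apply: eq_bigcupr => i _; exact: (BP i).2.
(* Witnesses for all the [F i] are chosen at once and packed into one real, whose section [i] serves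
   [F i]. *)
exists (\bigcap_i (fun p : X * N => (p.1, sec i p.2)) @^-1` (B i)).
  rewrite setC_bigcap; apply: (IH _ _ _).1 => i; rewrite preimage_setC.
  by apply: sigma_preimage; [cont|exact: (BP i).1].
rewrite eqEsubset; split=> [x Fx|_ [[x u] /= Bu <-] i _]; last first.
  by rewrite (BP i).2; exists (x, sec i u) => //; exact: Bu.
have /choice[u uP] i : exists u, B i (x, u).
  have := Fx i I; rewrite (BP i).2 => -[[y u] /= Bu <-]; by exists u.
by exists (x, weave u) => // i _ /=; rewrite sec_weave.
Qed.

Lemma sigma_bigcup (n : nat) (X : topologicalType) (F : nat -> set X) :
  (forall i, Sigma1 n (F i)) -> Sigma1 n (\bigcup_i F i).
Proof. by move=> /sigma_bigcupcap[]. Qed.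

Lemma sigma_bigcap (n : nat) (X : topologicalType) (F : nat -> set X) :
  (forall i, Sigma1 n (F i)) -> Sigma1 n (\bigcap_i F i).
Proof. by move=> /sigma_bigcupcap[]. Qed.

Lemma sigma_ex (n : nat) (X : topologicalType) (A : set (X * N)) :
  Sigma1 n.+1 A -> Sigma1 n.+1 [set x | exists u, A (x, u)].
Proof.
move=> [B sB ->].
exists ((fun p : X * N => ((p.1, sec 0 p.2), sec 1 p.2)) @^-1` B).
  by rewrite preimage_setC; apply: sigma_preimage => //; cont.
rewrite eqEsubset; split => [x /= [u [[[y v] w]/= Bw [<- _]]]|_ [[x u] /= Bu <-]].
  exists (y, weave (fun i => if i is 0 then v else w)) => //=.
  by rewrite !sec_weave.
by exists (sec 0 u), (x, sec 0 u, sec 1 u).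
Qed.

Lemma pi_sigma (n : nat) (X : topologicalType) (A : set X) :
  Pi1 n A -> Sigma1 n.+1 A.
Proof.
move=> pA; exists (fst @^-1` A); last first.
  rewrite eqEsubset; split=> [x Ax|_ [[x u] /= Ax <-]//].
  by exists (x, point).
by rewrite preimage_setC; apply: sigma_preimage => //; cont.
Qed.

Lemma sigma_mono (n : nat) (X : topologicalType) (A : set X) :
  Sigma1 n A -> Sigma1 n.+1 A.
Proof.
elim: n X A => [|n IH] X A sA; first by apply: pi_sigma; exact: borelC.
have [B sB ->] := sA; exists B => //; exact: IH.
Qed.

Lemma sigma_delta (n : nat) (X : topologicalType) (A : set X) :
  Sigma1 n A -> Delta1 n.+1 A.
Proof.
move=> sA; split; first exact: sigma_mono.
by apply: pi_sigma; rewrite /Pi1/= setCK.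
Qed.

Lemma deltaC (n : nat) (X : topologicalType) (A : set X) :
  Delta1 n A -> Delta1 n (~` A).
Proof. by move=> [sA pA]; split => //; rewrite /Pi1/= setCK. Qed.

Lemma pi_delta (n : nat) (X : topologicalType) (A : set X) :
  Pi1 n A -> Delta1 n.+1 A.
Proof. by move=> pA; rewrite -[A]setCK; apply/deltaC/sigma_delta. Qed.

Lemma delta_preimage (n : nat) (X Y : topologicalType) (f : X -> Y) (A : set Y) :
  continuous f -> Delta1 n A -> Delta1 n (f @^-1` A).
Proof.
move=> fc [sA pA]; split; first exact: sigma_preimage.
by rewrite /Pi1/= preimage_setC; exact: sigma_preimage.
Qed.

Lemma delta_bigcup (n : nat) (X : topologicalType) (F : nat -> set X) :
  (forall i, Delta1 n (F i)) -> Delta1 n (\bigcup_i F i).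
Proof.
move=> dF; split; first by apply: sigma_bigcup => i; exact: (dF i).1.
by rewrite /Pi1/= setC_bigcup; apply: sigma_bigcap => i; exact: (dF i).2.
Qed.

Section delta_predicates.
Variables (n : nat) (X : topologicalType).

(** The closure properties are phrased for comprehensions, so that the complexity of a formula is
    computed connective by connective. *)
Lemma sigma_all (P : nat -> X -> Prop) :
  (forall i, Sigma1 n [set x | P i x]) -> Sigma1 n [set x | forall i, P i x].
Proof.
move=> sP; rewrite (_ : [set x | _] = \bigcap_i [set x | P i x]).
  exact: sigma_bigcap.
by rewrite eqEsubset; split => [x Px i _|x Px i]; [exact: Px|exact: Px i I].
Qed.

Lemma sigma_and (P Q : X -> Prop) :
  Sigma1 n [set x | P x] -> Sigma1 n [set x | Q x] -> Sigma1 n [set x | P x /\ Q x].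
Proof.
move=> sP sQ.
rewrite (_ : [set x | _] = [set x | forall i, (if i is 0 then P else Q) x]).
  by apply: sigma_all => -[].
rewrite eqEsubset; split => [x [Px Qx] [|i]//|x PQ].
by split; [exact: (PQ 0)|exact: (PQ 1)].
Qed.

Lemma delta_exn (P : nat -> X -> Prop) :
  (forall i, Delta1 n [set x | P i x]) -> Delta1 n [set x | exists i, P i x].
Proof.
move=> dP; rewrite (_ : [set x | _] = \bigcup_i [set x | P i x]).
  exact: delta_bigcup.
by rewrite eqEsubset; split => [x [i Pi]|x [i _ Pi]]; exists i.
Qed.

Lemma delta_not (P : X -> Prop) :
  Delta1 n [set x | P x] -> Delta1 n [set x | ~ P x].
Proof. exact: deltaC. Qed.

Lemma delta_all (P : nat -> X -> Prop) :
  (forall i, Delta1 n [set x | P i x]) -> Delta1 n [set x | forall i, P i x].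
Proof.
move=> dP; rewrite (_ : [set x | _] = [set x | ~ exists i, ~ P i x]).
  by apply/delta_not/delta_exn => i; apply: delta_not.
by rewrite eqEsubset; split => x /= => [Px [i]|/forallNP Px i]; [|apply: contrapT].
Qed.

Lemma delta_and (P Q : X -> Prop) :
  Delta1 n [set x | P x] -> Delta1 n [set x | Q x] -> Delta1 n [set x | P x /\ Q x].
Proof.
move=> sP sQ.
rewrite (_ : [set x | _] = [set x | forall i, (if i is 0 then P else Q) x]).
  by apply: delta_all => -[].
rewrite eqEsubset; split => [x [Px Qx] [|i]//|x PQ].
by split; [exact: (PQ 0)|exact: (PQ 1)].
Qed.

Lemma delta_imp (P Q : X -> Prop) :
  Delta1 n [set x | P x] -> Delta1 n [set x | Q x] -> Delta1 n [set x | P x -> Q x].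
Proof.
move=> sP sQ; rewrite (_ : [set x | _] = [set x | ~ (P x /\ ~ Q x)]).
  by apply/delta_not/delta_and => //; apply: delta_not.
by rewrite eqEsubset; split => x /= => [PQ [/PQ]|PQ Px] //; apply: contrapT => Qx; exact: PQ.
Qed.

Lemma delta_or (P Q : X -> Prop) :
  Delta1 n [set x | P x] -> Delta1 n [set x | Q x] -> Delta1 n [set x | P x \/ Q x].
Proof.
move=> dP dQ; rewrite (_ : mkset _ = [set x | ~ P x -> Q x]).
  by apply: delta_imp => //; apply: delta_not.
rewrite eqEsubset; split=> x /= => [[Px nPx|//]|PQ]; first by case: nPx.
by have [|/PQ] := pselect (P x); [left|right].
Qed.

Lemma delta_iff (P Q : X -> Prop) :
  Delta1 n [set x | P x] -> Delta1 n [set x | Q x] -> Delta1 n [set x | P x <-> Q x].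
Proof. by move=> dP dQ; apply: delta_and; apply: delta_imp. Qed.

Lemma borel_delta (A : set X) : Borel A -> Delta1 n A.
Proof.
have s (B : set X) m : Borel B -> Sigma1 m B.
  by move=> BB; elim: m => // m; exact: sigma_mono.
by move=> BA; split; apply: s => //; exact: borelC.
Qed.

Lemma delta_const (P : Prop) : Delta1 n [set x : X | P].
Proof.
apply: borel_delta; have [p|p] := pselect P.
  rewrite (_ : mkset _ = setT); first by apply: borel_open; exact: openT.
  by rewrite eqEsubset; split.
rewrite (_ : mkset _ = set0); first by apply: borel_open; exact: open0.
by rewrite eqEsubset; split.
Qed.

Lemma pi_imp (P Q : X -> Prop) :
  Sigma1 n [set x | P x] -> Pi1 n [set x | Q x] -> Pi1 n [set x | P x -> Q x].
Proof.
move=> sP pQ; rewrite /Pi1/= (_ : ~` _ = [set x | P x /\ ~ Q x]); first exact: sigma_and.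
by rewrite eqEsubset; split=> x /= => [/not_implyP|[Px nQx] /(_ Px)].
Qed.

(** Any set defined through [f] is a countable union of fibers, and so is its complement. Hence an
    upper bound on one side suffices for the fibers. *)
Lemma delta_fiber (f : X -> nat) (P : nat -> Prop) :
  (forall k, Sigma1 n [set x | f x = k]) -> Delta1 n [set x | P (f x)].
Proof.
have s Q : (forall k, Sigma1 n [set x | f x = k]) -> Sigma1 n [set x | Q (f x)].
  move=> sf; rewrite (_ : mkset _ = \bigcup_k [set x | f x = k /\ Q k]).
    by apply: sigma_bigcup => k; apply: sigma_and => //; have [] := delta_const (Q k).
  by rewrite eqEsubset; split=> [x Qx|x [k _ [<-]]]; [exists (f x)|].
by move=> sf; split; [exact: s|exact: (s (fun k => ~ P k))].
Qed.

End delta_predicates.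

Section coordinates.
Variables (X : topologicalType) (f : X -> N).
Hypothesis fc : continuous f.

Lemma open_coord (k : nat) (P : nat -> Prop) : open [set x | P (f x k)].
Proof.
rewrite (_ : mkset _ = (fun x => f x k) @^-1` P) //.
have fk := cts_comp fc (@coord_continuous k).
apply: open_comp; first by move=> x _; exact: fk.
by rewrite openE => y Py; apply/principal_filterP.
Qed.

Lemma closed_coord (k : nat) (P : nat -> Prop) : closed [set x | P (f x k)].
Proof. by rewrite -openC; exact: (open_coord k (fun v => ~ P v)). Qed.

Lemma delta_coord (n k : nat) (P : nat -> Prop) : Delta1 n [set x | P (f x k)].
Proof. by apply: borel_delta; apply: borel_open; exact: open_coord. Qed.

End coordinates.

Arguments open_coord {X f} fc k P.
Arguments closed_coord {X f} fc k P.
Arguments delta_coord {X f} fc n k P.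

Lemma closed_baire_eq (X : topologicalType) (f g : X -> N) :
  continuous f -> continuous g -> closed [set x | f x = g x].
Proof.
move=> fc gc.
(* Equality says that [f x n = k] implies [g x n = k] for all [n] and [k], and each such implication
   is a clopen condition. *)
rewrite (_ : mkset _ = \bigcap_(nk in @setT (nat * nat))
   ([set x | f x nk.1 <> nk.2] `|` [set x | g x nk.1 = nk.2])).
  apply: closed_bigI => -[n k] _ /=; apply: closedU.
    exact: (closed_coord fc n (fun v => v <> k)).
  exact: (closed_coord gc n (fun v => v = k)).
rewrite eqEsubset; split=> [x /= fg [n k] _ /=|x h].
  by rewrite -fg; have [|] := pselect (f x n = k); [right|left].
by apply/funext => n; have [|->] := h (n, f x n) I.
Qed.

Lemma delta_eq (n : nat) (X : topologicalType) (f g : X -> N) :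
  continuous f -> continuous g -> Delta1 n [set x | f x = g x].
Proof.
move=> fc gc; apply: borel_delta; rewrite -[X in Borel X]setCK; apply: borelC; apply: borel_open.
by rewrite openC; exact: closed_baire_eq.
Qed.

Section real_quantifiers.
Variables (n : nat) (X : topologicalType) (P : X -> N -> Prop).

Lemma sigma_exr : Sigma1 n.+1 [set p : X * N | P p.1 p.2] ->
  Sigma1 n.+1 [set x | exists u, P x u].
Proof. exact: sigma_ex. Qed.

Lemma delta_exr : Sigma1 n.+1 [set p : X * N | P p.1 p.2] ->
  Delta1 n.+2 [set x | exists u, P x u].
Proof. by move=> sP; apply/sigma_delta/sigma_exr. Qed.

Lemma pi_allr : Pi1 n.+1 [set p : X * N | P p.1 p.2] ->
  Pi1 n.+1 [set x | forall u, P x u].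
Proof.
move=> pP; rewrite /Pi1/= (_ : ~` _ = [set x | exists u, ~ P x u]); first exact: sigma_ex pP.
by rewrite eqEsubset; split => x /= => [/existsNP//|[u nP] /(_ u)].
Qed.

End real_quantifiers.

(** * Borel and analytic sets as projections of closed sets *)

Definition tail (u : N) : N := fun k => u k.+1.

Lemma tail_continuous : continuous tail.
Proof. by apply: baire_continuous => k; exact: coord_continuous. Qed.


Section proj_closed.
Implicit Types (A : set N) (C : set (N * N)).

Let Q A := exists2 C : set (N * N), closed C & A = fst @` C.

(** The first entry of the witness names an index [i], and its tail is a witness for membership in
    [F i]. *)
Let proj_closed_bigcup (F : nat -> set N) : (forall i, Q (F i)) -> Q (\bigcup_i F i).
Proof.
move=> QF; have /choice[C CP] i : exists C : set (N * N), closed C /\ F i = fst @` C.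
  by have [C ? ?] := QF i; exists C.
pose s (p : N * N) := (p.1, tail p.2).
exists (\bigcap_i ([set p | p.2 0 <> i] `|` s @^-1` C i)).
  apply: closed_bigI => i _; apply: closedU.
    exact: (closed_coord (@cts_snd _ _) 0 (fun v => v <> i)).
  apply: closed_comp (CP i).1 => p _.
  apply: cts_pair; cont.
  exact: (cts_comp (@cts_snd _ _) tail_continuous).
rewrite eqEsubset; split=> [x [i _]|_ [[x v] /= Cv <-]].
  rewrite (CP i).2 => -[[y u] /= Cu <-].
  pose v : N := fun k => if k is k'.+1 then u k' else i.
  exists (y, v) => //= j _; have [<-|ij] := eqVneq i j; last first.
    by left => /= ij'; rewrite ij' eqxx in ij.
  by right; rewrite /s /= (_ : tail v = u).
have [//|Cx] := Cv (v 0) I; exists (v 0) => //.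
by rewrite (CP _).2; exists (x, tail v).
Qed.

Let proj_closed_bigcap (F : nat -> set N) : (forall i, Q (F i)) -> Q (\bigcap_i F i).
Proof.
move=> QF; have /choice[C CP] i : exists C : set (N * N), closed C /\ F i = fst @` C.
  by have [C ? ?] := QF i; exists C.
exists (\bigcap_i (fun p : N * N => (p.1, sec i p.2)) @^-1` (C i)).
  by apply: closed_bigI => i _; apply: closed_comp (CP i).1 => p _; move: p; cont.
rewrite eqEsubset; split=> [x Fx|_ [[x u] /= Cu <-] i _]; last first.
  by rewrite (CP i).2; exists (x, sec i u) => //; exact: Cu.
have /choice[u uP] i : exists u, C i (x, u).
  by have := Fx i I; rewrite (CP i).2 => -[[y u] /= Cu <-]; exists u.
by exists (x, weave u) => // i _ /=; rewrite sec_weave.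
Qed.

Let proj_closed_closed A : closed A -> Q A.
Proof.
move=> cA; exists (fst @^-1` A); first by apply: closed_comp cA => p _; move: p; cont.
rewrite eqEsubset; split=> [x Ax|_ [[x u] /= Ax <-]//].
by exists (x, point).
Qed.

(** An open set is the union over [n] of the closed sets of points whose cylinder of length [n] lies
    inside it. *)
Let proj_closed_open A : open A -> Q A.
Proof.
move=> oA.
rewrite (_ : A = \bigcup_n [set u | agree n u `<=` A]).
  apply: proj_closed_bigcup => n; apply: proj_closed_closed.
  rewrite -openC openE => u /= uA; apply/nbhs_agreeP; exists n => v uv vA.
  apply: uA => w uw; apply: vA => i im; rewrite uw// uv//.
rewrite eqEsubset; split => [u Au|u [n _] nA]; last exact: nA.
have /nbhs_agreeP[n nA] : nbhs u A by exact: open_nbhs_nbhs.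
by exists n.
Qed.

Lemma borel_proj_closed A : Borel A -> exists2 C : set (N * N), closed C & A = fst @` C.
Proof.
(* Projections do not commute with complements, so the induction carries a set together with its
   complement. *)
suff QQ : Borel A -> Q A /\ Q (~` A) by move/QQ; case.
move: A; apply: borel_ind => [A oA|A [? ?]|F QF].
- by split; [exact: proj_closed_open|apply: proj_closed_closed; rewrite closedC].
- by rewrite setCK.
- rewrite setC_bigcup; split; [apply: proj_closed_bigcup|apply: proj_closed_bigcap] => i;
  by have [] := QF i.
Qed.

End proj_closed.

(** A real [u] codes a pair: [sec 0 u] codes a triple of [m], [w] and a witness that [(m, w)] is in
    [A], and [sec 1 u] certifies through a closed set that the triple is correct. The map [pi] reads
    off [w], so its values on the section of [F] at [m] form the section of [A] at [m]. *)
Lemma sigma11_closed (A : set (N * N)) : Sigma1 1 A ->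
  exists (F : set (N * N)) (pi : N -> N), [/\ closed F, continuous pi &
    forall m w, A (m, w) <-> exists2 u, F (m, u) & pi u = w].
Proof.
move=> [B /borelC]; rewrite setCK => bB ->.
pose t (u : N) := ((sec 0 u, sec 1 u), sec 2 u).
have /borel_proj_closed[C cC BC] : Borel (t @^-1` B).
  by apply: borel_preimage bB; rewrite /t; cont.
exists [set p : N * N | C (sec 0 p.2, sec 1 p.2) /\ sec 0 (sec 0 p.2) = p.1].
exists (fun u => sec 1 (sec 0 u)); split; last 2 first.
- by cont.
- move=> m w; split=> [[[[m' w'] v] /= Bv [<- <-]]|[u [/= Cu <-] <-]].
    pose b := weave (fun i => if i is 0 then m' else if i is 1 then w' else v).
    have : (t @^-1` B) b by rewrite /t /= !sec_weave.
    rewrite BC => -[[b' c] /= Cb bb'].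
    exists (weave (fun i => if i is 0 then b' else c)); last by rewrite !sec_weave bb' sec_weave.
    by rewrite /= !sec_weave bb' sec_weave; split=> //; rewrite -bb'.
  have : (t @^-1` B) (sec 0 u) by rewrite BC; exists (sec 0 u, sec 1 u).
  by move=> /= Bu; exists (t (sec 0 u)).
apply: closedI.
  by apply: (@closed_comp _ _ (fun p : N * N => (sec 0 p.2, sec 1 p.2)) C) => // p _;
    move: p; cont.
by apply: closed_baire_eq; cont.
Qed.

(** * The derivative of a closed set with countable image *)

Lemma countable_enum (T : Type) (A : set T) :
  countable A -> A !=set0 -> exists c : nat -> T, A = range c.
Proof.
move=> /countable_injP[f finj] [a0 Aa0].
have /choice[c cP] n : exists a, A a /\ (forall b, A b -> f b = n -> b = a).
  have [[a [Aa fa]]|/forallNP h] := pselect (exists a, A a /\ f a = n).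
    by exists a; split=> // b Ab fb; apply: finj; rewrite ?inE// fa.
  (* Numbers that code no element of [A] are sent to the default [a0]. *)
  by exists a0; split=> // b Ab fb; case: (h b).
exists c; rewrite eqEsubset; split=> [a Aa|_ [n _ <-]]; last exact: (cP n).1.
by exists (f a) => //; rewrite -((cP (f a)).2 a).
Qed.

(** Relations on the naturals are coded by reals, so that a real quantifier can range over them. *)
Definition prec (r : N) (t s : nat) : Prop := r (pickle (t, s)) <> 0.

Lemma prec_code (P : nat -> nat -> Prop) :
  exists r : N, forall t s, prec r t s <-> P t s.
Proof.
exists (fun k => if unpickle k is Some (t, s) then `[< P t s >] : nat else 0).
move=> t s; rewrite /prec pickleK; split=> [|/asboolP->//].
by case: asboolP.
Qed.

Definition below (r : N) (s : nat) : set nat := [set t | prec r t s].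

(** Descending sequences are themselves reals, which makes this visibly $\Pi^1_1$. *)
Definition founded (r : N) : Prop := forall f : N, exists n, ~ prec r (f n.+1) (f n).

Lemma founded_min (r : N) (A : set nat) : founded r -> A !=set0 ->
  exists2 s, A s & forall t, A t -> ~ prec r t s.
Proof.
move=> rf [a Aa]; apply: contrapT => h.
have /choice[g gP] s : exists t, A s -> A t /\ prec r t s.
  apply: contrapT => /forallNP k; apply: h; exists s.
    by apply: contrapT => As; apply: (k 0).
  by move=> t At ts; apply: (k t).
pose f : N := fun n => iter n g a.
have fA n : A (f n) by elim: n => //= n An; exact: (gP _ An).1.
by have [n] := rf f; apply; exact: (gP _ (fA n)).2.
Qed.

(** A number coding no sequence is read as the empty sequence, whose cylinder is the whole space. *)
Definition node (s : nat) : seq nat := odflt [::] (unpickle s).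

Definition extends (s : nat) (u : N) : Prop :=
  forall i, (i < size (node s))%N -> u i = nth 0 (node s) i.

Definition stem (n : nat) (u : N) : nat := pickle (mkseq u n).

Lemma extends_stem (n : nat) (u v : N) : extends (stem n u) v <-> agree n u v.
Proof.
rewrite /extends /node /stem pickleK /= size_mkseq.
by split=> uv i im; have := uv i im; rewrite nth_mkseq.
Qed.

Definition avoids (U : set nat) (u : N) : Prop := forall t, U t -> ~ extends t u.

Section derivative.
Variables (G : set N) (pi : N -> N).

(* [resolved U s]: once the nodes of U are removed, at most one value of pi is
   left below the node s. *)
Definition resolved (U : set nat) (s : nat) : Prop := forall u v,
  G u -> G v -> extends s u -> extends s v -> avoids U u -> avoids U v -> pi u = pi v.

Lemma resolvedS (U W : set nat) (s : nat) :
  U `<=` W -> resolved U s -> resolved W s.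
Proof.
move=> UW Us u v Gu Gv su sv Wu Wv.
by apply: Us => // t /UW Wt; [exact: Wu|exact: Wv].
Qed.

(** The strict part of a prewellorder, with incomparability made transitive by the third clause. The
    last two clauses say that a node is removed no sooner and no later than it becomes resolved. *)
Definition ranking (r : N) : Prop :=
  founded r /\
  (forall a b c, prec r a b -> prec r b c -> prec r a c) /\
  (forall a b c, prec r a c -> prec r a b \/ prec r b c) /\
  (forall s, resolved (below r s) s) /\
  (forall s t, resolved (below r s) t -> ~ prec r s t).

(** At an [r]-least node [s] where the initial segments differ, the two relations agree below every
    [r]-predecessor of [s]. A node preceding [s] in only one of them then makes some node resolved
    strictly before it is removed, against the last clause of [ranking]. Uniqueness concerns the
    relations only, since a relation has many codes. *)
Lemma ranking_unique (r r' : N) : ranking r -> ranking r' ->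
  forall s, below r s = below r' s.
Proof.
move=> [wf [tr [nt [res up]]]] [wf' [tr' [nt' [res' up']]]].
apply: contrapT => /existsNP[s0 s0P].
have [s /= sP smin] := @founded_min r [set s | below r s <> below r' s] wf
  (ex_intro _ s0 s0P).
have {}smin q : prec r q s -> below r q = below r' q.
  by move=> qs; apply: contrapT => /smin; apply.
apply: sP; rewrite eqEsubset; split=> [t /= ts|].
  apply: contrapT => ts'; apply: (up t s) => //; rewrite (smin _ ts).
  by apply: resolvedS (res' s) => q qs; have [|/ts'] := nt' q t s qs.
apply: contrapT => /existsNP[t1 /not_implyP t1P].
have [t /= [ts' ts] tmin] := @founded_min r' [set t | prec r' t s /\ ~ prec r t s] wf'
  (ex_intro _ t1 t1P).
have [st|/existsNP[q /not_implyP[qs qt']]] := pselect (below r s `<=` below r' t).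
  by apply: (up' t s) => //; exact: resolvedS st (res s).
have tq : below r' t `<=` below r' q by move=> x xt; have [|/qt'] := nt' x q t xt.
have : ~ prec r q t by apply: up; rewrite (smin _ qs); exact: resolvedS (res' t).
by have [|/ts] := nt q t s qs.
Qed.

(** The stages of the transfinite derivative, generated without ordinals. The empty stage is the
    union of the empty family. *)
Inductive stage : set nat -> Prop :=
| stage_step U : stage U -> stage (U `|` resolved U)
| stage_sup (D : set (set nat)) : (forall U, D U -> stage U) -> stage (\bigcup_(U in D) U).

(** Zermelo's double induction: stages are linearly ordered by inclusion, with nothing strictly
    between a stage and its successor. *)
Lemma stage_chain (U W : set nat) : stage U -> stage W ->
  U `<=` W \/ W `|` resolved W `<=` U.
Proof.
move=> sU; elim: sU W => {U} [U sU IU W|D sD ID W sW].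
  suff dich : forall V, stage V -> V `<=` U \/ U `|` resolved U `<=` V.
    move=> sW; have [WU|UW] := dich _ sW; last by left.
    have [UW|] := IU _ sW; last by move=> h; right => x /h; left.
    by right; rewrite (_ : W = U)// eqEsubset.
  move=> V; elim=> {V} [V sV IV|D sD ID].
    have [VU|UV] := IV; last by right => x /UV; left.
    have [UV|] := IU _ sV; last by left.
    by right; rewrite (_ : V = U)// eqEsubset.
  have [h|/existsNP[V /not_implyP[DV VU]]] := pselect (forall V, D V -> V `<=` U).
    by left => x [V DV Vx]; exact: (h V).
  by right => x xU; exists V => //; have [/VU|] := ID _ DV; [|apply].
have [h|/existsNP[V /not_implyP[DV VW]]] := pselect (forall V, D V -> V `<=` W).
  by left => x [V DV Vx]; exact: (h V).
by right => x xW; exists V => //; have [/VW|] := ID _ DV W sW; [|apply].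
Qed.

Hypothesis G_closed : closed G.
Hypothesis pi_continuous : continuous pi.
Hypothesis piG_countable : countable (pi @` G).

(* Baire category: if the nodes of W do not cover G, every node meeting the rest
   of G sees two values of pi, so the countably many values of pi on G can be
   avoided one after the other. *)
Lemma resolved_covers (W : set nat) : resolved W `<=` W ->
  forall u, G u -> ~ avoids W u.
Proof.
move=> resW u0 Gu0 Wu0.
have [c cP] := countable_enum piG_countable (ex_intro _ (pi u0) (imageP pi Gu0)).
pose S := {p : N * nat | G p.1 /\ avoids W p.1}.
(* A state is a point of [G] avoiding [W] together with a length. Step [k] stays in the current
   cylinder and moves to a longer one on which [pi] never takes the value [c k]. *)
have /choice[step stepP] (kp : nat * S) : exists q : S,
    let p := sval kp.2 in let q := sval q in
    [/\ agree p.2 p.1 q.1, (p.2 < q.2)%N & forall v, agree q.2 q.1 v -> pi v <> c kp.1].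
  case: kp => k [[u n] /= [Gu Wu]].
  have [u' [Gu' Wu' uu' u'c]] :
      exists u', [/\ G u', avoids W u', agree n u u' & pi u' <> c k].
    apply: contrapT => /forallNP h.
    have e u' : G u' -> avoids W u' -> agree n u u' -> pi u' = c k.
      by move=> *; apply: contrapT => ?; apply: (h u').
    (* If only the value [c k] were left in the cylinder, its node would be resolved and hence in
       [W], although [u] passes through it. *)
    apply: (Wu (stem n u)); last by apply/extends_stem.
    apply: resW => v w Gv Gw /extends_stem uv /extends_stem uw Wv Ww.
    by rewrite !e.
  have [i ui] : exists i, pi u' i <> c k i.
    by apply: contrapT => /forallNP h; apply: u'c; apply/funext => i; apply: contrapT.
  have : nbhs u' [set v | agree i.+1 (pi u') (pi v)].
    by apply: (pi_continuous (x := u')); exact: nbhs_agree.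
  move=> /nbhs_agreeP[m um].
  (* Length [m] keeps [pi] away from [c k] by continuity; [n.+1] forces the lengths to grow, so that
     the points converge. *)
  exists (exist _ (u', maxn n.+1 m) (conj Gu' Wu')) => /=; split=> //.
    exact: leq_maxl.
  by move=> v /(agree_leq (leq_maxr _ _)) /um /(_ i (ltnSn i)) vi vc; apply: ui; rewrite -vi vc.
pose s0 : S := exist _ (u0, 0) (conj Gu0 Wu0).
pose st := fix st (k : nat) : S := if k is k'.+1 then step (k', st k') else s0.
pose x k := (sval (st k)).1; pose n k := (sval (st k)).2.
have xS k : agree (n k) (x k) (x k.+1) by have [] := stepP (k, st k).
have nS k : (n k < n k.+1)%N by have [] := stepP (k, st k).
have kn k : (k <= n k)%N by elim: k => // k IH; exact: leq_ltn_trans IH (nS k).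
have nD k d : (n k <= n (k + d))%N.
  by elim: d => [|d IH]; rewrite ?addn0// addnS; exact: leq_trans IH (ltnW (nS _)).
have xD k d : agree (n k) (x k) (x (k + d)).
  elim: d => [|d IH]; first by rewrite addn0.
  move=> i ik; rewrite addnS xS ?IH//; exact: leq_trans ik (nD _ _).
have xx i k l : (i < n k)%N -> (i < n l)%N -> x k i = x l i.
  move=> ik il; wlog kl : k l ik il / (k <= l)%N.
    by move=> wl; have [/wl->|/ltnW/wl->] := leqP k l.
  by rewrite -(subnKC kl) xD.
(* The limit of the points: [n i.+1] exceeds [i], so entry [i] no longer changes from [x i.+1]
   on. *)
pose u : N := fun i => x i.+1 i.
have xu k : agree (n k) (x k) u by move=> i ik; apply: xx => //; exact: kn.
have Gu : G u.
  apply: G_closed => B /nbhs_agreeP[m mB]; exists (x m); split.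
    by have [] := proj2_sig (st m).
  by apply: mB => i im; rewrite (xu m)//; exact: leq_trans im (kn m).
have : (pi @` G) (pi u) by exists u.
rewrite cP => -[k _ ck]; have [_ _ /(_ u (xu k.+1))] := stepP (k, st k).
by rewrite ck.
Qed.

(** One node precedes another when some stage contains the first and omits the second. Thus
    [below r s] is the largest stage omitting [s], and its successor must contain [s]. *)
Lemma ranking_exists : exists r, ranking r.
Proof.
have [r rP] := prec_code (fun t s => exists U, [/\ stage U, U t & ~ U s]).
have belowE s : below r s = \bigcup_(U in [set U | stage U /\ ~ U s]) U.
  rewrite eqEsubset; split=> [t /rP[U [sU Ut Us]]|t [U [sU Us] Ut]].
    by exists U.
  by apply/rP; exists U.
have stage_below s : stage (below r s).
  by rewrite belowE; apply: stage_sup => U [].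
have below_s s : ~ below r s s by rewrite belowE => -[U [_]].
(* A stage that gains nothing contains every node: no point of [G] avoids it, so every node is
   vacuously resolved. *)
have irr W : (stage W) -> resolved W `<=` W -> forall s, W s.
  move=> sW WW s; apply: (WW) => u v Gu _ _ _ Wu _.
  by have := resolved_covers WW Gu Wu.
have tr a b c : prec r a b -> prec r b c -> prec r a c.
  move=> /rP[U [sU Ua Ub]] /rP[W [sW Wb Wc]]; apply/rP.
  exists W; split => //; have [UW|WU] := stage_chain sU sW; first exact: UW.
  by case: Ub; apply: WU; left.
exists r; split; [|split=> //; split; [|split]].
- move=> f; apply: contrapT => /forallNP fP.
  have {}fP n : prec r (f n.+1) (f n) by apply: contrapT.
  (* The largest stage disjoint from the descending sequence. Its successor contains some [f n],
     while a stage containing [f n.+1] is not inside [W], hence includes that successor and cannot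
     omit [f n]. *)
  pose W := \bigcup_(U in [set U | stage U /\ forall n, ~ U (f n)]) U.
  have sW : stage W by apply: stage_sup => U [].
  have Wf n : ~ W (f n) by move=> [U [_]] /(_ n).
  have [n rn] : exists n, resolved W (f n).
    apply: contrapT => /forallNP h; apply: (Wf 0); apply: (irr _ sW) => s rs.
    exists (W `|` resolved W); last by right.
    by split=> [|n [/Wf//|/h//]]; exact: stage_step.
  have /rP[U [sU Un1 Un]] := fP n.
  have [UW|WU] := stage_chain sU sW; first exact: (Wf n.+1 (UW _ Un1)).
  by apply: Un; apply: WU; right.
- move=> a b c /rP[U [sU Ua Uc]].
  by have [Ub|Ub] := pselect (U b); [right|left]; apply/rP; exists U.
- move=> s; apply: contrapT => h; apply: (below_s s).
  apply: (irr _ (stage_below s)) => t rt; rewrite belowE.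
  exists (below r s `|` resolved (below r s)); last by right.
  by split=> [|[/below_s//|/h//]]; apply: stage_step; exact: stage_below.
- move=> s t res /rP[U [sU Us Ut]].
  have [UW|WU] := stage_chain sU (stage_below s); first exact: (below_s s (UW _ Us)).
  by apply: Ut; apply: WU; right.
Qed.

Definition assigned (r : N) (s : nat) (z : N) : Prop :=
  exists u, G u /\ extends s u /\ avoids (below r s) u /\ pi u = z.

(** The point [u] survives until the first node through it is removed, and that node is assigned
    [pi u]. *)
Lemma assigned_exists (r : N) (u : N) : ranking r -> G u -> exists s, assigned r s (pi u).
Proof.
move=> [rf _] Gu.
have [|s us smin] := @founded_min r [set s | extends s u] rf.
  by exists (stem 0 u); apply/extends_stem.
by exists s, u; do 2!split=> //; split=> // t ts /smin; apply.
Qed.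

Lemma assigned_inj (r : N) (s : nat) (z z' : N) : ranking r ->
  assigned r s z -> assigned r s z' -> z = z'.
Proof.
by move=> [_ [_ [_ [res _]]]] [u [Gu [su [au <-]]]] [v [Gv [sv [av <-]]]]; apply: (res s).
Qed.

End derivative.

(** * Complexity of enumerations and rankings *)

Definition enumerates (S : set (N * N)) (x y : N) : Prop :=
  (forall n, S (x, sec n y)) /\ forall z, S (x, z) -> exists n, z = sec n y.

Lemma delta_enumerates (S : set (N * N)) : Sigma1 1 S ->
  Delta1 2 [set p : N * N | enumerates S p.1 p.2].
Proof.
move=> sS; apply: delta_and.
  apply: delta_all => n; apply: sigma_delta.
  by apply: (sigma_preimage (f := fun p : N * N => (p.1, sec n p.2)) _ sS); cont.
apply: pi_delta; apply: pi_allr; apply: pi_imp.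
  by apply: (sigma_preimage (f := fun p : N * N * N => (p.1.1, p.2)) _ sS); cont.
have [] // : Delta1 1 [set p : N * N * N | exists n, p.2 = sec n p.1.2].
by apply: delta_exn => n; apply: delta_eq; cont.
Qed.

Section definability.
Variables (F : set (N * N)) (pi : N -> N).
Hypothesis F_closed : closed F.
Hypothesis pi_continuous : continuous pi.

Let G m := [set u | F (m, u)].

Section generic.
Variables (n : nat) (X : topologicalType).

Lemma delta_prec (f : X -> N) (t s : nat) : continuous f ->
  Delta1 n [set x | prec (f x) t s].
Proof. by move=> fc; exact: (delta_coord fc n (pickle (t, s)) (fun v => v <> 0)). Qed.

Lemma delta_extends (f : X -> N) (s : nat) : continuous f ->
  Delta1 n [set x | extends s (f x)].
Proof.
move=> fc; apply: delta_all => i; apply: delta_imp; first exact: delta_const.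
exact: (delta_coord fc n i (fun v => v = nth 0 (node s) i)).
Qed.

Lemma delta_avoids (f g : X -> N) (s : nat) : continuous f -> continuous g ->
  Delta1 n [set x | avoids (below (f x) s) (g x)].
Proof.
move=> fc gc; apply: delta_all => t; apply: delta_imp; first exact: delta_prec.
by apply/delta_not/delta_extends.
Qed.

Lemma delta_F (f g : X -> N) : continuous f -> continuous g ->
  Delta1 n [set x | F (f x, g x)].
Proof.
move=> fc gc; apply: (delta_preimage (f := fun x => (f x, g x))).
  exact: cts_pair.
apply: borel_delta; rewrite -[F]setCK; apply: borelC; apply: borel_open.
by rewrite openC.
Qed.

End generic.

Lemma delta_founded : Delta1 2 [set r | founded r].
Proof.
apply: pi_delta; apply: pi_allr.
have [] // : Delta1 1 [set p : N * N | exists n, ~ prec p.1 (p.2 n.+1) (p.2 n)].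
apply: delta_exn => n; apply: delta_not.
(* The entries of [p.2] index into [p.1]; quantifying over their values leaves only conditions on
   fixed coordinates. *)
rewrite (_ : mkset _ = [set p : N * N |
    exists a b, (p.2 n.+1 = a /\ p.2 n = b) /\ prec p.1 a b]).
  apply: delta_exn => a; apply: delta_exn => b; apply: delta_and.
    apply: delta_and.
      exact: (delta_coord (@cts_snd _ _) 1 n.+1 (fun v => v = a)).
    exact: (delta_coord (@cts_snd _ _) 1 n (fun v => v = b)).
  by apply: delta_prec; cont.
rewrite eqEsubset; split=> [p pp|p [a [b [[<- <-]]]]//].
by exists (p.2 n.+1), (p.2 n).
Qed.

Lemma delta_resolved (s t : nat) :
  Delta1 2 [set p : N * N | resolved (G p.1) pi (below p.2 s) t].
Proof.
apply: pi_delta; apply: pi_allr; apply: pi_allr.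
set A := mkset _; have [] // : Delta1 1 A; rewrite /A.
apply: delta_imp; first by apply: delta_F; cont.
apply: delta_imp; first by apply: delta_F; cont.
apply: delta_imp; first by apply: delta_extends; cont.
apply: delta_imp; first by apply: delta_extends; cont.
apply: delta_imp; first by apply: delta_avoids; cont.
apply: delta_imp; first by apply: delta_avoids; cont.
by apply: delta_eq; apply: (cts_comp _ pi_continuous); cont.
Qed.

Lemma delta_ranking : Delta1 2 [set p : N * N | ranking (G p.1) pi p.2].
Proof.
apply: delta_and; first exact: delta_preimage (@cts_snd _ _) delta_founded.
apply: delta_and.
  do 3 apply: delta_all => ?.
  by apply: delta_imp; [|apply: delta_imp]; apply: delta_prec; cont.
apply: delta_and.
  do 3 apply: delta_all => ?.
  by apply: delta_imp; [|apply: delta_or]; apply: delta_prec; cont.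
apply: delta_and; first by apply: delta_all => s; exact: delta_resolved.
do 2 apply: delta_all => ?; apply: delta_imp; first exact: delta_resolved.
by apply: delta_not; apply: delta_prec; cont.
Qed.

Lemma delta_assigned (s : nat) :
  Delta1 2 [set q : N * N * N | assigned (G q.1.1) pi q.1.2 s q.2].
Proof.
apply: delta_exr; set A := mkset _; have [] // : Delta1 1 A; rewrite /A.
apply: delta_and; first by apply: delta_F; cont.
apply: delta_and; first by apply: delta_extends; cont.
apply: delta_and; first by apply: delta_avoids; cont.
by apply: delta_eq; [apply: (cts_comp _ pi_continuous)|]; cont.
Qed.

End definability.

(** * Coding connected components *)

Section class_coding.
Variables (R0 : rel N) (S : set (N * N)).
Hypothesis R0_wo : well_order R0.
Hypothesis R0_delta : Delta1 2 [set p : N * N | R0 p.1 p.2].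
Hypothesis S_sigma : Sigma1 1 S.
Hypothesis S_refl : forall x, S (x, x).
Hypothesis S_sym : forall x y, S (x, y) -> S (y, x).
Hypothesis S_trans : forall y x z, S (x, y) -> S (y, z) -> S (x, z).
Hypothesis S_countable : forall x, countable [set y | S (x, y)].

(** A prescribed element is put in position 0, which lets an enumeration carry the least element of
    the class at its head. *)
Lemma enumerates_exists (x a : N) : S (x, a) ->
  exists y, enumerates S x y /\ sec 0 y = a.
Proof.
move=> xa; have [c cP] := countable_enum (S_countable x) (ex_intro _ x (S_refl x)).
exists (weave (fun n => if n is k.+1 then c k else a)).
split; last by rewrite sec_weave.
have cS k : S (x, c k) by rewrite -[S _]/([set y | S (x, y)] (c k)) cP; exists k.
split=> [[|n]|z xz]; rewrite ?sec_weave//.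
have : [set y | S (x, y)] z by [].
by rewrite cP => -[k _ <-]; exists k.+1; rewrite sec_weave.
Qed.

Let least x m := S (x, m) /\ forall z, S (x, z) -> R0 m z.

Let least_exists x : exists m, least x m.
Proof.
have [|m [[mA mle] _]] := R0_wo (A := [pred z | `[< S (x, z) >]]).
  by exists x; rewrite inE; exact: S_refl.
move: mA; rewrite inE => xm; exists m; split=> // z xz.
by apply: mle; rewrite inE.
Qed.

Let least_unique x m m' : least x m -> least x m' -> m = m'.
Proof.
move=> [xm mle] [xm' m'le].
have [|z [_ zuniq]] := R0_wo (A := [pred z | `[< S (x, z) >]]).
  by exists x; rewrite inE; exact: S_refl.
have e a : least x a -> z = a.
  move=> [xa ale]; apply: zuniq; split; first by rewrite inE.
  by move=> b; rewrite inE; exact: ale.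
by rewrite -(e m)// -(e m').
Qed.

Let least_class x x' m : S (x, x') -> least x m -> least x' m.
Proof.
move=> xx' [xm mle]; split; first exact: S_trans (S_sym xx') xm.
by move=> z /(S_trans xx'); exact: mle.
Qed.

(** The code of [x] is the least node assigned [x] in the ranking built over the least element
    [mu x] of its class. Points of one class share [mu], and a node is assigned at most one
    value. *)
Lemma class_code : exists iota : N -> nat,
  (forall s, Delta1 2 [set x | iota x = s]) /\
  forall x x', S (x, x') -> iota x = iota x' -> x = x'.
Proof.
have [F [pi [Fc pic SE]]] := sigma11_closed S_sigma.
pose G m := [set u | F (m, u)].
have Gc m : closed (G m).
  have mc : continuous (fun u : N => (m, u)).
    by apply: cts_pair; [move=> u; exact: cvg_cst|cont].
  by apply: (@closed_comp _ _ (fun u : N => (m, u)) F) => // u _; exact: mc.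
have piG m : countable (pi @` G m).
  rewrite (_ : pi @` G m = [set w | S (m, w)]); first exact: S_countable.
  by rewrite eqEsubset; split=> [_ [u Gu <-]|w /SE[u Gu uw]]; [apply/SE; exists u|exists u].
have /choice[mu muP] := least_exists.
have /choice[rho rhoP] m := ranking_exists (Gc m) pic (piG m).
pose asg x s := assigned (G (mu x)) pi (rho (mu x)) s x.
have /choice[iota iotaP] x : exists s, asg x s /\ forall s', (s' < s)%N -> ~ asg x s'.
  have : exists s, `[< asg x s >].
    have /SE[u Fu ux] : S (mu x, x) by apply: S_sym; exact: (muP x).1.
    have [s us] := assigned_exists (rhoP (mu x)) (Fu : G (mu x) u).
    by exists s; apply/asboolP; rewrite /asg -{3}ux.
  move=> ex; case: (ex_minnP ex) => s /asboolP ass smin; exists s; split=> // s' ss'.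
  by move=> /asboolP /smin; rewrite leqNgt ss'.
(* The witness [w] packs an enumeration of the class of [x], headed by its least element, and a
   ranking over that element. Minimality is then tested by a number quantifier. *)
pose M x s (w : N) := enumerates S x (sec 0 w) /\
  (forall n, R0 (sec 0 (sec 0 w)) (sec n (sec 0 w))) /\
  ranking (G (sec 0 (sec 0 w))) pi (sec 1 w) /\
  assigned (G (sec 0 (sec 0 w))) pi (sec 1 w) s x /\
  forall s', (s' < s)%N -> ~ assigned (G (sec 0 (sec 0 w))) pi (sec 1 w) s' x.
have iotaE x s : iota x = s <-> exists w, M x s w.
  split=> [<-|[w [[Sy ySE] [ylow [rk [ass nass]]]]]].
    have [y [yx y0]] := enumerates_exists (muP x).1.
    exists (weave (fun i => if i is 0 then y else rho (mu x))).
    rewrite /M !sec_weave y0; split=> //; split.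
      by move=> n; apply: (muP x).2; exact: yx.1.
    by split=> //; exact: iotaP.
  have ymu : sec 0 (sec 0 w) = mu x.
    apply: (@least_unique x) (muP x); split; first exact: Sy.
    by move=> z /ySE[n ->].
  rewrite ymu in rk ass nass.
  (* The guessed ranking may differ from [rho (mu x)] as a real, but [assigned] depends only on its
     initial segments. *)
  have asgE s' : assigned (G (mu x)) pi (sec 1 w) s' x = asg x s'.
    by rewrite /asg /assigned (ranking_unique rk (rhoP (mu x))).
  rewrite asgE in ass.
  have [ai ni] := iotaP x.
  have [lt|lt|//] := ltngtP (iota x) s.
    by have := nass _ lt; rewrite asgE.
  by case: (ni s).
exists iota; split.
  move=> s; apply: (delta_fiber (f := iota) (eq^~ s)) => {}s.
  rewrite (_ : mkset _ = [set x | exists w, M x s w]); last first.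
    by rewrite eqEsubset; split=> x /=; rewrite iotaE.
  apply: sigma_exr; set A := mkset _; have [] // : Delta1 2 A; rewrite /A.
  have assD s' : Delta1 2 [set p : N * N |
      assigned (G (sec 0 (sec 0 p.2))) pi (sec 1 p.2) s' p.1].
    apply: (delta_preimage (f := fun p : N * N => (sec 0 (sec 0 p.2), sec 1 p.2, p.1)) _
      (delta_assigned Fc pic s')); cont.
  apply: delta_and.
    by apply: (delta_preimage (f := fun p : N * N => (p.1, sec 0 p.2)) _
      (delta_enumerates S_sigma)); cont.
  apply: delta_and.
    apply: delta_all => n.
    by apply: (delta_preimage (f := fun p : N * N => (sec 0 (sec 0 p.2), sec n (sec 0 p.2))) _
      R0_delta); cont.
  apply: delta_and.
    by apply: (delta_preimage (f := fun p : N * N => (sec 0 (sec 0 p.2), sec 1 p.2)) _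
      (delta_ranking Fc pic)); cont.
  apply: delta_and; first exact: assD.
  by apply: delta_all => s'; apply: delta_imp; [exact: delta_const|exact/delta_not/assD].
move=> x x' xx' ii.
have mm : mu x = mu x' by apply: least_unique (muP x'); exact: least_class (muP x).
have [ax _] := iotaP x; have [ax' _] := iotaP x'.
by apply: (assigned_inj (rhoP (mu x))) ax _; rewrite ii mm.
Qed.

End class_coding.

(** * Connected components of a locally countable graph *)

Section connectedness.
Variable E : set (N * N).
Hypothesis E_sigma : Sigma1 1 E.
Hypothesis E_sym : is_graph E.
Hypothesis E_countable : locally_countable E.

Fixpoint reach (n : nat) : set (N * N) :=
  if n is k.+1 then [set p | exists z, reach k (p.1, z) /\ E (z, p.2)]
  else [set p | p.1 = p.2].

Definition connected_by : set (N * N) := \bigcup_n reach n.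

Lemma sigma_connected : Sigma1 1 connected_by.
Proof.
apply: sigma_bigcup; elim=> [|n IH].
  by have [] : Delta1 1 [set p : N * N | p.1 = p.2] by apply: delta_eq; cont.
apply: sigma_exr; apply: sigma_and.
  by apply: (sigma_preimage (f := fun p : N * N * N => (p.1.1, p.2)) _ IH); cont.
by apply: (sigma_preimage (f := fun p : N * N * N => (p.2, p.1.2)) _ E_sigma); cont.
Qed.

Lemma connected_refl x : connected_by (x, x).
Proof. by exists 0. Qed.

Lemma connected_edge x y : E (x, y) -> connected_by (x, y).
Proof. by move=> xy; exists 1 => //; exists x. Qed.

Lemma connected_trans y x z :
  connected_by (x, y) -> connected_by (y, z) -> connected_by (x, z).
Proof.
move=> [m _ xy] [n _]; elim: n z => [z /= <-|n IH z [w [/IH[k _ xw] wz]]].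
  by exists m.
by exists k.+1 => //; exists w.
Qed.

Lemma connected_sym x y : connected_by (x, y) -> connected_by (y, x).
Proof.
move=> [n _]; elim: n y => [y /= ->|n IH y [w [/IH wx wy]]].
  exact: connected_refl.
by apply: connected_trans wx; apply: connected_edge; exact: E_sym.
Qed.

Lemma connected_countable x : countable [set y | connected_by (x, y)].
Proof.
rewrite (_ : mkset _ = \bigcup_n [set y | reach n (x, y)]); last first.
  by rewrite eqEsubset; split=> y [n _ ?]; exists n.
apply: bigcup_countable => // n _; elim: n => [|n IH].
  rewrite (_ : mkset _ = [set x]); first exact: countable1.
  by rewrite eqEsubset; split=> y.
rewrite (_ : mkset _ = \bigcup_(z in [set z | reach n (x, z)]) [set y | E (z, y)]).
  by apply: bigcup_countable => // z _; exact: E_countable.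
by rewrite eqEsubset; split=> y /= => [[z [? ?]]|[z ? ?]]; exists z.
Qed.

End connectedness.

(** * Leftmost colorings *)

Definition lex_le (d e : N) : Prop := forall n, agree n d e -> (d n <= e n)%N.

Definition leftmost (Z : set N) (d : N) : Prop := Z d /\ forall e, Z e -> lex_le d e.

Lemma leftmost_unique (Z : set N) (d e : N) : leftmost Z d -> leftmost Z e -> d = e.
Proof.
move=> [Zd dle] [Ze ele]; apply/funext => n; elim/ltn_ind: n => n IH.
by apply/eqP; rewrite eqn_leq dle ?ele// => i im; rewrite IH.
Qed.

(** Greedy choice: step [k] keeps the first [k] entries and minimizes the next one within [Z]. The
    limit lies in [Z] by the second hypothesis, which is closedness. *)
Lemma leftmost_exists (Z : set N) : Z !=set0 ->
  (forall d, (forall n, exists2 e, Z e & agree n d e) -> Z d) ->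
  exists d, leftmost Z d.
Proof.
move=> [e0 Ze0] Zclosed.
have /choice[step stepP] (ke : nat * {e | Z e}) : exists e : {e | Z e},
    agree ke.1 (sval ke.2) (sval e) /\
    forall e', Z e' -> agree ke.1 (sval ke.2) e' -> (sval e ke.1 <= e' ke.1)%N.
  case: ke => k [e Ze] /=.
  have ex : exists v, `[< exists e', [/\ Z e', agree k e e' & e' k = v] >].
    by exists (e k); apply/asboolP; exists e.
  case: (ex_minnP ex) => v /asboolP[e' [Ze' ee' <-]] vmin.
  exists (exist _ e' Ze'); split=> //= e'' Ze'' ee''.
  by apply: vmin; apply/asboolP; exists e''.
pose st := fix st (k : nat) := if k is k'.+1 then step (k', st k') else exist Z e0 Ze0.
pose x k : N := sval (st k).
have xS k : agree k (x k) (x k.+1) by have [] := stepP (k, st k).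
have xD k m : agree k (x k) (x (k + m)).
  elim: m => [|m IH]; first by rewrite addn0.
  by move=> i ik; rewrite addnS xS ?IH//; exact: leq_trans ik (leq_addr _ _).
pose d : N := fun i => x i.+1 i.
have xd k : agree k (x k) d by move=> i ik; rewrite /d -(subnKC ik) xD.
exists d; split.
  apply: Zclosed => n; exists (x n); first exact: (proj2_sig (st n)).
  by move=> i im; rewrite (xd n).
move=> e Ze n de; have [_] := stepP (n, st n); apply => // i im.
by rewrite de// (xd n).
Qed.

Section bounded_coloring.
Variables (E S : set (N * N)) (iota : N -> nat) (n : nat) (c0 : N -> nat).
Hypothesis E_sigma : Sigma1 1 E.
Hypothesis S_sigma : Sigma1 1 S.
Hypothesis S_refl : forall x, S (x, x).
Hypothesis S_sym : forall x y, S (x, y) -> S (y, x).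
Hypothesis S_trans : forall y x z, S (x, y) -> S (y, z) -> S (x, z).
Hypothesis S_countable : forall x, countable [set y | S (x, y)].
Hypothesis E_S : forall x y, E (x, y) -> S (x, y).
Hypothesis iota_delta : forall s, Delta1 2 [set x | iota x = s].
Hypothesis iota_inj : forall x x', S (x, x') -> iota x = iota x' -> x = x'.
Hypothesis c0_bound : forall x, (c0 x < n)%N.
Hypothesis c0_coloring : coloring E c0.

(** Here [g] codes a relation on the naturals, meant to be the image under [iota] of the edges of
    one component. *)
Let code_colorings (g : N) : set N :=
  [set d | (forall i, (d i < n)%N) /\ forall i j, prec g i j -> d i <> d j].

Let conflict (x : N) (i j : nat) : Prop :=
  exists a b, [/\ S (x, a), S (x, b), iota a = i, iota b = j & E (a, b)].

Let conflict_class x y i j : S (x, y) -> conflict x i j -> conflict y i j.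
Proof.
move=> /S_sym yx [a [b [xa xb ai bj ab]]].
by exists a, b; split=> //; apply: S_trans yx _.
Qed.

Let code_coloring_exists (g x : N) : (forall i j, prec g i j <-> conflict x i j) ->
  code_colorings g !=set0.
Proof.
move=> gP; have /choice[d dP] i : exists v, (v < n)%N /\
    forall a, S (x, a) -> iota a = i -> v = c0 a.
  have [[a [xa ai]]|h] := pselect (exists a, S (x, a) /\ iota a = i).
    exists (c0 a); split=> // b xb bi; congr c0; apply: iota_inj; last by rewrite ai.
    exact: S_trans (S_sym xa) xb.
  (* Numbers that are not codes of points in the class get the default color [c0 x], which is below
     [n]. *)
  exists (c0 x); split=> // a xa ai; by case: h; exists a.
exists d; split=> [i|i j /gP[a [b [xa xb ai bj ab]]]]; first exact: (dP i).1.
by rewrite ((dP i).2 a)// ((dP j).2 b)//; exact: c0_coloring.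
Qed.

Let code_colorings_closed (g d : N) :
  (forall k, exists2 e, code_colorings g e & agree k d e) -> code_colorings g d.
Proof.
move=> dP; split=> [i|i j gij].
  by have [e [eb _] de] := dP i.+1; rewrite -de.
have [e [_ ec] de] := dP (maxn i j).+1.
by rewrite -!de ?ltnS ?leq_maxl ?leq_maxr//; exact: ec.
Qed.

Let delta_leftmost :
  Delta1 2 [set p : N * N | leftmost (code_colorings p.1) p.2].
Proof.
have dZ (X : topologicalType) (f g : X -> N) : continuous f -> continuous g ->
    Delta1 1 [set x | code_colorings (f x) (g x)].
  move=> fc gc; apply: delta_and.
    by apply: delta_all => i; exact: (delta_coord gc 1 i (fun v => (v < n)%N)).
  apply: delta_all => i; apply: delta_all => j; apply: delta_imp; first exact: delta_prec.
  apply: (delta_not (P := fun x => g x i = g x j)).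
  rewrite (_ : mkset _ = [set x | forall v, g x i = v <-> g x j = v]).
    apply: delta_all => v; apply: delta_iff; [exact: (delta_coord gc 1 i (eq^~ v))|].
    exact: (delta_coord gc 1 j (eq^~ v)).
  by rewrite eqEsubset; split=> x /= => [->//|/(_ (g x j))[_ ->]].
have [s p] : Delta1 1 [set q : N * N | code_colorings q.1 q.2] by apply: dZ; cont.
apply: delta_and; first exact: sigma_delta.
apply: pi_delta; apply: pi_allr; set A := mkset _; have [] // : Delta1 1 A; rewrite /A.
apply: delta_imp; first by apply: dZ; cont.
apply: delta_all => k; apply: delta_imp.
  apply: delta_all => i; apply: delta_imp; first exact: delta_const.
  rewrite (_ : mkset _ = [set x : N * N * N | forall v, x.2 i = v <-> x.1.2 i = v]).
    apply: delta_all => v; apply: delta_iff.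
      by apply: (delta_coord (f := fun x : N * N * N => x.2) _ 1 i (eq^~ v)); cont.
    by apply: (delta_coord (f := fun x : N * N * N => x.1.2) _ 1 i (eq^~ v)); cont.
  by rewrite eqEsubset; split=> x /= => [->//|/(_ (x.1.2 i))[_ ->]].
rewrite (_ : mkset _ = [set x : N * N * N | forall v, x.2 k = v -> (x.1.2 k <= v)%N]).
  apply: delta_all => v; apply: delta_imp.
    by apply: (delta_coord (f := fun x : N * N * N => x.2) _ 1 k (eq^~ v)); cont.
  by apply: (delta_coord (f := fun x : N * N * N => x.1.2) _ 1 k (fun w => (w <= v)%N)); cont.
by rewrite eqEsubset; split=> x /= => [h v <-//|]; apply.
Qed.

(** The color of [x] is the entry at [iota x] of the leftmost coloring of its coded component.
    Adjacent points have the same coded component, hence read the same leftmost coloring, at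
    conflicting positions. *)
Lemma bounded_coloring : exists c : N -> nat,
  [/\ forall x, (c x < n)%N, coloring E c & forall k, Delta1 2 [set x | c x = k]].
Proof.
have /choice[g gP] x := prec_code (conflict x).
have /choice[d dP] x := leftmost_exists (code_coloring_exists (gP x))
  (@code_colorings_closed (g x)).
have codes_eq h h' : (forall i j, prec h i j <-> prec h' i j) ->
    code_colorings h = code_colorings h'.
  move=> hh; rewrite eqEsubset; split=> e [eb ec]; split=> // i j;
  by rewrite -?hh ?hh => ?; apply: ec; rewrite ?hh// -?hh.
have d_class x y : S (x, y) -> d x = d y.
  move=> xy; apply: leftmost_unique (dP y); rewrite -(codes_eq (g x)) => [|i j]; first exact: dP.
  by rewrite !gP; split; apply: conflict_class => //; exact: S_sym.
(* The sections of [w] are an enumeration of the class, a code for its conflict relation, and the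
   leftmost coloring of that code. The enumeration turns quantifiers over the class into number
   quantifiers. *)
pose M x k (w : N) := enumerates S x (sec 0 w) /\
  (forall i j, prec (sec 1 w) i j <-> exists p q, (iota (sec p (sec 0 w)) = i /\
     iota (sec q (sec 0 w)) = j) /\ E (sec p (sec 0 w), sec q (sec 0 w))) /\
  leftmost (code_colorings (sec 1 w)) (sec 2 w) /\
  forall s, iota x = s -> sec 2 w s = k.
have conflictE x y i j : enumerates S x y -> conflict x i j <->
    exists p q, (iota (sec p y) = i /\ iota (sec q y) = j) /\ E (sec p y, sec q y).
  move=> [Sy ySE]; split=> [[a [b [/ySE[p ->] /ySE[q ->] pi qj pq]]]|[p [q [[pi qj] pq]]]].
    by exists p, q.
  by exists (sec p y), (sec q y).
exists (fun x => d x (iota x)); split.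
- by move=> x; have [[]] := dP x.
- move=> x y xy; rewrite (d_class x y (E_S xy)).
  have [[_ yc] _] := dP y; apply: yc; apply/gP; exists x, y; split=> //.
  exact/S_sym/E_S.
move=> k; apply: (delta_fiber (f := fun x => d x (iota x)) (eq^~ k)) => {}k.
rewrite (_ : mkset _ = [set x | exists w, M x k w]); last first.
  rewrite eqEsubset; split=> x /= => [xk|[w [yx [gw [lw wk]]]]].
    have [y [yx _]] := enumerates_exists S_refl S_countable (S_refl x).
    exists (weave (fun i => if i is 0 then y else if i is 1 then g x else d x)).
    rewrite /M !sec_weave; split=> //; split; last by split=> // s <-.
    by move=> i j; rewrite gP; exact: conflictE.
  rewrite -(wk _ erefl); suff -> : d x = sec 2 w by [].
  apply: leftmost_unique (dP x) _.
  rewrite (codes_eq (g x) (sec 1 w))// => i j; rewrite gP gw; exact: conflictE.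
apply: sigma_exr; set A := mkset _; have [] // : Delta1 2 A; rewrite /A.
have d_iota (X : topologicalType) (f : X -> N) s : continuous f ->
    Delta1 2 [set x | iota (f x) = s].
  by move=> fc; exact: delta_preimage fc (iota_delta s).
apply: delta_and.
  by apply: (delta_preimage (f := fun p : N * N => (p.1, sec 0 p.2)) _
    (delta_enumerates S_sigma)); cont.
apply: delta_and.
  do 2 apply: delta_all => ?; apply: delta_iff; first by apply: delta_prec; cont.
  apply: delta_exn => p; apply: delta_exn => q; apply: delta_and.
    by apply: delta_and; apply: d_iota; cont.
  apply: sigma_delta.
  by apply: (sigma_preimage (f := fun x : N * N => (sec p (sec 0 x.2), sec q (sec 0 x.2))) _
    E_sigma); cont.
apply: delta_and.
  by apply: (delta_preimage (f := fun p : N * N => (sec 1 p.2, sec 2 p.2)) _ delta_leftmost);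
    cont.
apply: delta_all => s; apply: delta_imp; first by apply: d_iota; cont.
by apply: (delta_coord (f := fun p : N * N => sec 2 p.2) _ 2 s (eq^~ k)); cont.
Qed.

End bounded_coloring.

(** An infinite [K] contains a copy of the naturals, into which [iota] is composed. A finite [K] is
    identified with an initial segment of the naturals to apply [bounded_coloring]. *)
Lemma delta_coloring_baire (R0 : rel N) (E : set (N * N)) (K : Type) (c0 : N -> K) :
  well_order R0 -> Delta1 2 [set p : N * N | R0 p.1 p.2] ->
  Sigma1 1 E -> is_graph E -> locally_countable E -> coloring E c0 ->
  exists c : N -> K, coloring E c /\ forall P : K -> Prop, Delta1 2 [set x | P (c x)].
Proof.
move=> wo R0d sE symE ctE colE.
have sS := sigma_connected sE; have Sr := @connected_refl E.
have Ss := @connected_sym E symE; have St := @connected_trans E.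
have Sc := connected_countable ctE; have ES := @connected_edge E.
have [iota [iotad iotai]] := class_code wo R0d sS Sr Ss St Sc.
have [Kfin|Kinf] := pselect (finite_set [set: K]); last first.
  have /card_leP[f] := (infiniteP _).1 Kinf.
  pose h n := val (f (to_setT n)).
  have hi : injective h.
    by move=> m n /val_inj /(@inj _ _ _ f) /= => /(_ (mem_setT _) (mem_setT _)) [].
  exists (fun x => h (iota x)); split.
    move=> x y xy /hi /(iotai _ _ (ES _ _ xy)) exy; apply: (colE _ _ xy).
    by rewrite exy.
  move=> P; apply: (delta_fiber (f := iota) (fun s => P (h s))) => s.
  by have [] := iotad s.
have [n /card_set_bijP[f [fn fi fs]]] := Kfin.
have c0n x : (f (c0 x) < n)%N by exact: (fn (c0 x) I).
have c0c : coloring E (fun x => f (c0 x)).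
  by move=> x y xy /fi; rewrite !inE => /(_ I I); exact: colE.
have [c [cn cc cd]] := bounded_coloring sE sS Sr Ss St Sc ES iotad iotai c0n c0c.
have /choice[h hP] v : exists k, (v < n)%N -> f k = v.
  (* Outside the range of [f] the inverse takes an arbitrary default; the colors [c x] never reach
     it. *)
  have [vn|vn] := pselect (v < n)%N; last by exists (c0 point).
  by have [k _ kv] := fs v vn; exists k.
exists (fun x => h (c x)); split.
  by move=> x y xy hh; apply: (cc _ _ xy); rewrite -(hP _ (cn x)) -(hP _ (cn y)) hh.
move=> P; apply: (delta_fiber (f := c) (fun s => P (h s))) => s.
by have [] := cd s.
Qed.

(** * Metric presentation of a Polish space *)

Import Order.TTheory GRing.Theory Num.Theory.
Local Open Scope ring_scope.

(** The distance is pulled back from a complete homeomorphic copy. Completeness is recorded only for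
    sequences with the fixed rate [eps], the form in which addresses use it. *)
Lemma polish_dist (V : topologicalType) (v0 : V) : polish V ->
  exists (R : realType) (d : V -> V -> R) (p : nat -> V) (eps : nat -> R),
  [/\ [/\ forall x, d x x = 0, forall x y, d x y = d y x, forall x y, d x y = 0 -> x = y &
        forall y x z, d x z <= d x y + d y z],
      forall U x, nbhs x U <-> exists2 r : R, 0 < r & forall y, d x y < r -> U y,
      forall x (r : R), 0 < r -> exists j, d x (p j) < r,
      (forall n, 0 < eps n) /\ forall r : R, 0 < r -> exists n, eps n < r &
      forall u : nat -> V, (forall n m, d (u n) (u m) < eps n + eps m) ->
        exists x, forall n, d x (u n) <= eps n].
Proof.
move=> [[D Dc Dd] [R [M [Mc [f [g [fK gK fc gc]]]]]]].
have D0 : D !=set0 by have [|z [_ Dz]] := Dd setT _ openT; [exists v0|exists z].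
have [p pD] := countable_enum Dc D0.
pose d x y : R := mdist (f x) (f y).
have d_sym x y : d x y = d y x by exact: metric_sym.
have d_tri y x z : d x z <= d x y + d y z by exact: metric_triangle.
have dn U x : nbhs x U <-> exists2 r : R, 0 < r & forall y, d x y < r -> U y.
  split=> [xU|[r r0 rU]].
    have : nbhs (f x) (g @^-1` U) by apply: gc; rewrite fK.
    move=> /nbhs_ballP[r /= r0 rU]; exists r => // y dxy.
    by rewrite -(fK y); apply: rU; rewrite ballEmdist.
  have xr : nbhs x (f @^-1` ball (f x) r) by apply: fc; exact: nbhsx_ballx.
  by apply: filterS xr => y; rewrite /= ballEmdist; exact: rU.
pose eps n : R := n.+1%:R^-1.
have eps_gt0 n : 0 < eps n by rewrite invr_gt0 ltr0n.
have eps_le n m : (n <= m)%N -> eps m <= eps n.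
  by move=> nm; rewrite lef_pV2 ?posrE ?ltr0n// ler_nat.
have eps_small (r : R) : 0 < r -> exists n, eps n < r.
  by move=> /ltr_add_invr[k]; rewrite add0r; exists k.
clearbody eps; exists R, d, p, eps; split=> //.
- split.
  + by move=> x; exact: mdistxx.
  + exact: d_sym.
  + by move=> x y /mdist_positivity; exact: (can_inj fK).
  + exact: d_tri.
- move=> x r r0.
  have xr : (interior [set y | d x y < r]) x by apply/dn; exists r.
  have [y [/interior_subset /= xy]] := Dd _ (ex_intro _ x xr) (@open_interior _ _).
  by rewrite pD => -[j _ jy]; exists j; rewrite jy.
move=> u ud.
pose F := (fun n => f (u n)) @ \oo.
have [|l Fl] := Mc F _ _.
  suff cb (e : R) : 0 < e -> \forall x & y \near F, ball x e y by apply/cauchy_ballP.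
  move=> e0; near_simpl.
  have [k ke] := eps_small (e / 2) ltac:(lra).
  exists ([set n | (k <= n)%N], [set n | (k <= n)%N]); first by split; exists k.
  move=> [n m] [/= kn km]; rewrite ballEmdist /=; apply: lt_trans (ud n m) _.
  by have := eps_le _ _ kn; have := eps_le _ _ km; lra.
exists (g l) => n; rewrite leNgt; apply/negP => ln.
(* Half of the excess over [eps n]: a late term within [r] of the limit and with [eps m < r]
   contradicts the triangle inequality. *)
pose r := (d (g l) (u n) - eps n) / 2.
have r0 : 0 < r by rewrite /r; lra.
have : nbhs l (ball l r) by exact: nbhsx_ballx.
move=> /Fl[m0 _ m0l]; have [k kr] := eps_small _ r0.
pose m := maxn m0 k.
have := m0l m (leq_maxl _ _); rewrite /= ballEmdist /= => lm.
have {}lm : d (g l) (u m) < r by rewrite /d gK.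
have km : eps m <= eps k by apply: eps_le; exact: leq_maxr.
have := d_tri (u m) (g l) (u n); rewrite (d_sym (u m)).
have := ud n m; move: kr lm km; rewrite /r; clear -R => *; lra.
Qed.

(** * From the Baire space to Polish spaces *)

Section address.
Variables (V : topologicalType) (R : realType) (d : V -> V -> R) (p : nat -> V)
  (eps : nat -> R).
Hypothesis dxx : forall x, d x x = 0.
Hypothesis d_sym : forall x y, d x y = d y x.
Hypothesis d_eq0 : forall x y, d x y = 0 -> x = y.
Hypothesis d_tri : forall y x z, d x z <= d x y + d y z.
Hypothesis d_nbhs : forall (U : set V) x,
  nbhs x U <-> exists2 r : R, 0 < r & forall y, d x y < r -> U y.
Hypothesis p_dense : forall x (r : R), 0 < r -> exists j, d x (p j) < r.
Hypothesis eps_gt0 : forall n, 0 < eps n.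
Hypothesis eps_small : forall r : R, 0 < r -> exists n, eps n < r.
Hypothesis d_complete : forall u : nat -> V,
  (forall n m, d (u n) (u m) < eps n + eps m) -> exists x, forall n, d x (u n) <= eps n.

Definition address (x : V) (a : N) : Prop := forall n,
  d x (p (a n)) < eps n /\ forall j, (j < a n)%N -> ~ d x (p j) < eps n.

Lemma address_exists x : exists a, address x a.
Proof.
suff /choice[a aP] n : exists k, d x (p k) < eps n /\
    forall j, (j < k)%N -> ~ d x (p j) < eps n by exists a.
case: (ex_minnP (p_dense x (eps_gt0 n))) => k kn kmin; exists k; split=> // j jk.
by move=> /kmin; rewrite leqNgt jk.
Qed.

Lemma address_unique x a b : address x a -> address x b -> a = b.
Proof.
move=> xa xb; apply/funext => n.
have [an amin] := xa n; have [bn bmin] := xb n.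
by have [/bmin|/amin|] := ltngtP (a n) (b n).
Qed.

Lemma address_inj x y a : address x a -> address y a -> x = y.
Proof.
move=> xa ya; apply: d_eq0; apply/eqP; rewrite eq_le; apply/andP; split; rewrite leNgt;
  apply/negP => dxy.
  have [n dn] := eps_small (r := d x y / 2) ltac:(lra).
  have [xn _] := xa n; have [yn _] := ya n.
  have := d_tri (p (a n)) x y; rewrite (d_sym (p _)); move: xn yn dn => *; lra.
have := d_tri y x x; rewrite dxx (d_sym y x); move: dxy => *; lra.
Qed.

(** The point is eliminated by measuring from its approximations [p (a m)], which are within [eps m]
    of it. A strict inequality becomes one holding with slack [eps m] for some [m], and its failure
    a bound for all [m]; completeness recovers the point. *)
Lemma addressableP (a : N) : (exists x, address x a) <->
  [/\ forall n m, d (p (a n)) (p (a m)) < eps n + eps m,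
      forall n, exists m, d (p (a m)) (p (a n)) + eps m < eps n &
      forall n j, (j < a n)%N -> forall m, eps n <= d (p (a m)) (p j) + eps m].
Proof.
split=> [[x xa]|[a1 a2 a3]].
  split=> [n m|n|n j jn m].
  - have [xn _] := xa n; have [xm _] := xa m.
    have := d_tri x (p (a n)) (p (a m)); rewrite (d_sym _ x).
    move: xn xm => *; lra.
  - have [xn _] := xa n.
    have [m mr] := eps_small (r := (eps n - d x (p (a n))) / 2) ltac:(lra).
    have [xm _] := xa m; exists m.
    have := d_tri x (p (a m)) (p (a n)); rewrite (d_sym _ x).
    move: xn mr xm => *; lra.
  - have [_ /(_ j jn)/negP] := xa n; rewrite -leNgt => xj.
    have [xm _] := xa m; have := d_tri (p (a m)) x (p j).
    move: xj xm => *; lra.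
have [x xa] := d_complete a1; exists x => n; split=> [|j jn].
  have [m mn] := a2 n; have := xa m; have := d_tri (p (a m)) x (p (a n)).
  move: mn => *; lra.
move=> xj; have [m mr] := eps_small (r := (eps n - d x (p j)) / 2) ltac:(lra).
have := a3 n j jn m; have := xa m; have := d_tri x (p (a m)) (p j); rewrite (d_sym _ x).
move: xj mr => *; lra.
Qed.

Let delta_coord2 (n m : nat) (P : nat -> nat -> Prop) :
  Delta1 0 [set a : N | P (a n) (a m)].
Proof.
rewrite (_ : mkset _ = [set a : N | forall i j, a n = i -> a m = j -> P i j]).
  do 2 apply: delta_all => ?; apply: delta_imp.
    exact: (delta_coord (@cts_id _) 0 n (eq^~ _)).
  apply: delta_imp; [exact: (delta_coord (@cts_id _) 0 m (eq^~ _))|exact: delta_const].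
by rewrite eqEsubset; split=> a /= => [Pa _ _ <- <-|]//; apply.
Qed.

Lemma delta_addressable : Delta1 0 [set a | exists x, address x a].
Proof.
rewrite (_ : mkset _ = [set a : N |
  (forall n m, d (p (a n)) (p (a m)) < eps n + eps m) /\
  ((forall n, exists m, d (p (a m)) (p (a n)) + eps m < eps n) /\
   (forall n m, (forall j, (j < a n)%N -> eps n <= d (p (a m)) (p j) + eps m)))]).
  apply: delta_and.
    apply: delta_all => n; apply: delta_all => m.
    exact: (delta_coord2 n m (fun i j => d (p i) (p j) < eps n + eps m)).
  apply: delta_and.
    apply: delta_all => n; apply: delta_exn => m.
    exact: (delta_coord2 m n (fun i j => d (p i) (p j) + eps m < eps n)).
  apply: delta_all => n; apply: delta_all => m.
  exact: (delta_coord2 n m (fun i k =>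
    forall j, (j < i)%N -> eps n <= d (p k) (p j) + eps m)).
rewrite eqEsubset; split=> a /=.
  by move=> /addressableP[a1 a2 a3]; split=> //; split=> // n m j jn; exact: a3.
by move=> [a1 [a2 a3]]; apply/addressableP; split=> // n j jn m; exact: a3.
Qed.

Definition addresses (B : set (V * V)) : set (N * N) :=
  [set q | exists x y, [/\ address x q.1, address y q.2 & B (x, y)]].

(** Membership in an open set is decided by two balls at some level [n]. The quantifiers over [V]
    then depend only on two indices and do not affect complexity. *)
Lemma addresses_open (B : set (V * V)) : open B -> addresses B = [set q : N * N |
  ((exists x, address x q.1) /\ (exists y, address y q.2)) /\
  exists n, forall j k, q.1 n = j -> q.2 n = k ->
    forall x y, d x (p j) < eps n -> d y (p k) < eps n -> B (x, y)].
Proof.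
move=> oB; rewrite eqEsubset; split=> [[a b] /= [x [y [xa yb Bxy]]]|[a b] /=]; last first.
  move=> [[[x xa] [y yb]] [n nB]]; exists x, y; split=> //.
  by apply: (nB _ _ erefl erefl); [exact: (xa n).1|exact: (yb n).1].
split; first by split; [exists x|exists y].
have : nbhs (x, y) B by exact: open_nbhs_nbhs.
move=> [[U W] /= [/d_nbhs[r r0 rU] /d_nbhs[s s0 sW]] UW].
(* The factor 2 is there because two points of one ball of radius [eps n] can be almost [2 * eps n]
   apart. *)
have [n nr] := eps_small (r := Num.min r s / 2) ltac:(by rewrite divr_gt0 ?lt_min ?r0 ?s0).
have minr : Num.min r s <= r by rewrite ge_min lexx.
have mins : Num.min r s <= s by rewrite ge_min lexx orbT.
exists n => _ _ <- <- x' y' xn yn; apply: UW; split=> /=.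
  apply: rU; have := d_tri (p (a n)) x x'; rewrite (d_sym (p _)).
  have := (xa n).1; move: nr minr xn => *; lra.
apply: sW; have := d_tri (p (b n)) y y'; rewrite (d_sym (p _)).
have := (yb n).1; move: nr mins yn => *; lra.
Qed.

(** Addresses determine points, so complements become complements relative to the Borel set of pairs
    of addresses. *)
Lemma borel_addresses (B : set (V * V)) : Borel B -> Borel (addresses B).
Proof.
have dI : Delta1 0 [set q : N * N | (exists x, address x q.1) /\ exists y, address y q.2].
  by apply: delta_and; apply: delta_preimage delta_addressable; cont.
move: B; apply: borel_ind => [B oB|B bB|F bF].
- rewrite addresses_open//; set A := mkset _; have [] // : Delta1 0 A; rewrite /A.
  apply: delta_and => //; apply: delta_exn => n; apply: delta_all => j; apply: delta_all => k.
  apply: delta_imp; first exact: (delta_coord (@cts_fst _ _) 0 n (eq^~ j)).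
  apply: delta_imp; first exact: (delta_coord (@cts_snd _ _) 0 n (eq^~ k)).
  exact: delta_const.
- rewrite (_ : addresses _ = [set q : N * N |
      ((exists x, address x q.1) /\ exists y, address y q.2) /\ ~ addresses B q]).
    by apply: (sigma_and (n := 0)); [case: dI|exact: borelC].
  rewrite eqEsubset; split=> [[a b] [x [y [xa yb nB]]]|[a b] /= [[[x xa] [y yb]] nB]].
    split; first by split; [exists x|exists y].
    move=> [x' [y' [/= x'a y'b]]].
    by rewrite -(address_inj xa x'a) -(address_inj yb y'b).
  by exists x, y; split=> // Bxy; apply: nB; exists x, y.
- rewrite (_ : addresses _ = \bigcup_n addresses (F n)); first exact: borel_bigcup.
  rewrite eqEsubset; split=> [q [x [y [? ? [n _ ?]]]]|q [n _ [x [y [? ? ?]]]]].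
    by exists n => //; exists x, y.
  by exists x, y; split=> //; exists n.
Qed.

Lemma delta_address (n : nat) : Delta1 n [set q : V * N | address q.1 q.2].
Proof.
have dd j i m : Delta1 m [set q : V * N | d q.1 (p j) < eps i].
  apply: borel_delta; apply: borel_open.
  apply: (@open_comp _ _ (@fst V N) [set x | d x (p j) < eps i]).
    by move=> x _; exact: cts_fst.
  rewrite openE => x /= xi; apply/d_nbhs; exists (eps i - d x (p j)); first by rewrite subr_gt0.
  move=> y xy /=; have := d_tri x y (p j); rewrite (d_sym y x).
  move: xy => *; lra.
apply: delta_all => i.
rewrite (_ : mkset _ = [set q : V * N | forall k, q.2 i = k ->
   d q.1 (p k) < eps i /\ forall j, (j < k)%N -> ~ d q.1 (p j) < eps i]).
  apply: delta_all => k; apply: delta_imp.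
    exact: (delta_coord (@cts_snd _ _) n i (eq^~ k)).
  apply: delta_and; first exact: dd.
  by apply: delta_all => j; apply: delta_imp; [exact: delta_const|apply: delta_not; exact: dd].
by rewrite eqEsubset; split=> q /= => [h _ <-//|]; apply.
Qed.

(** The map [adr] need not be continuous, but its graph is Borel, so the preimage and its complement
    are both defined by an existential real quantifier. *)
Lemma delta_at_address (adr : V -> N) (A : set N) :
  (forall x, address x (adr x)) -> Delta1 2 A -> Delta1 2 [set x | A (adr x)].
Proof.
move=> adrP.
suff s (B : set N) : Delta1 2 B -> Sigma1 2 [set x | B (adr x)].
  by move=> dA; split; [exact: s|apply: (s (~` A)); exact: deltaC].
move=> dB; rewrite (_ : mkset _ = [set x | exists a, address x a /\ B a]).
  apply: sigma_exr; apply: sigma_and; first by have [] := delta_address 2.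
  by have [] : Delta1 2 [set q : V * N | B q.2] by apply: delta_preimage dB; cont.
rewrite eqEsubset; split=> x /= => [Bx|[a [xa]]]; first by exists (adr x).
by rewrite (address_unique (adrP x) xa).
Qed.

End address.

Lemma delta_coloring (R0 : rel N) (V : topologicalType) (E : set (V * V)) (K : Type)
    (c0 : V -> K) :
  well_order R0 -> Delta1 2 [set p : N * N | R0 p.1 p.2] ->
  borel_graph E -> locally_countable E -> coloring E c0 ->
  exists c : V -> K, class_coloring (@Delta1 2 V) E c.
Proof.
move=> wo R0d [polV symE bE] ctE colE.
(* The empty space is settled apart, since [v0] supplies the default color of reals that are not
   addresses. *)
have [[v0]|V0] := pselect (exists v : V, True); last first.
  exists c0; split=> // k; rewrite (_ : _ @^-1` _ = [set x | False]).
    exact: delta_const.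
  by rewrite eqEsubset; split=> x //; case: V0; exists x.
have [R [d [p [eps [[d1 d2 d3 d4] d5 pd [e0 es] dc]]]]] := polish_dist v0 polV.
have /choice[adr adrP] := address_exists pd e0.
have inj := address_inj (p := p) d1 d2 d3 d4 es.
have bE' := borel_addresses p d1 d2 d3 d4 d5 es dc bE.
set E' := addresses d p eps E in bE'.
have symE' : is_graph E'.
  by move=> a b [x [y [xa yb xy]]]; exists y, x; split=> //; exact: symE.
have ctE' : locally_countable E'.
  move=> a; have [[x xa]|nx] := pselect (exists x, address d p eps x a); last first.
    rewrite (_ : mkset _ = set0); first exact: countable0.
    by rewrite eqEsubset; split=> b // [x [y [xa _ _]]]; case: nx; exists x.
  apply: (@sub_countable _ _ _ [set y | E (x, y)]); last exact: ctE.
  apply: (card_le_trans _ (card_image_le adr _)); apply: subset_card_le.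
  move=> b [x' [y [/= x'a yb xy]]]; exists y; last exact: address_unique (adrP y) yb.
  by rewrite /= (inj _ _ _ xa x'a).
have /choice[c0' c0'P] a : exists k, forall x, address d p eps x a -> k = c0 x.
  have [[x xa]|nx] := pselect (exists x, address d p eps x a).
    by exists (c0 x) => y ya; rewrite (inj _ _ _ xa ya).
  by exists (c0 v0) => x xa; case: nx; exists x.
have colE' : coloring E' c0'.
  by move=> a b [x [y [/= xa yb xy]]]; rewrite (c0'P _ _ xa) (c0'P _ _ yb); exact: colE.
have [c [cE cd]] := delta_coloring_baire wo R0d (sigma_mono (n := 0) bE') symE' ctE' colE'.
exists (fun x => c (adr x)); split.
  by move=> x y xy; apply: cE; exists x, y.
move=> k; exact: (delta_at_address d2 d4 d5 adrP (cd (eq^~ k))).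
Qed.

Theorem theorem4p4 :
  (exists R : rel baire_space,
      well_order R /\ Delta1 2 [set p : baire_space * baire_space | R p.1 p.2]) ->
  forall (V : topologicalType) (E : set (V * V)),
    borel_graph E -> locally_countable E -> chi_class (@Delta1 2 V) E = chi E.
Proof.
move=> [R0 [wo R0d]] V E bE ctE.
(* The types admitting a coloring and those admitting a $\Delta^1_2$ class coloring are the same, so
   the two minima agree. *)
rewrite eqEsubset; split=> K [[c cK] Kmin]; split.
- by exists c; case: cK.
- by move=> L [c' c'L]; apply: Kmin; exact: delta_coloring wo R0d bE ctE c'L.
- exact: delta_coloring wo R0d bE ctE cK.
- by move=> L [c' [c'L _]]; apply: Kmin; exists c'.
Qed.
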